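(* Let $P_\sigma(n)$ be defined by $\sum_{n=0}^{\infty}P_\sigma(n)q^n=\sigma(q)$, where $\sigma(q)=\sum_{n=0}^{\infty}\dfrac{q^{(n+1)(n+2)/2}(-q;q)_n}{(q;q^2)_{n+1}}$. Let $p\ge 5$ be any prime such that $\left(\dfrac{-2}{p}\right)=-1$. Then for any integer $\alpha\ge 0$, $$\sum_{n=0}^{\infty}P_\sigma\left(2\cdot p^{2\alpha}n+\dfrac{11\cdot p^{2\alpha}+1}{12}\right)q^n\equiv \ell_2\,\psi(q^3)\pmod 2,$$ and, for every integer $n\ge 0$ and $1\le j\le p-1$, $$P_\sigma\left(2\cdot p^{2\alpha+2}n+2\cdot p^{2\alpha+1}j+\dfrac{11\cdot p^{2\alpha+2}+1}{12}\right)\equiv 0\pmod 2.$$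
   Context: Notation: $(b;q)_n=\prod_{k=0}^{n-1}(1-bq^k)$, $(b;q)_\infty=\prod_{k=0}^{\infty}(1-bq^k)$, $\ell_k=(q^k;q^k)_\infty$, and $\psi(q)=\sum_{m=0}^{\infty}q^{m(m+1)/2}=\ell_2^2/\ell_1$. $\left(\frac{\cdot}{p}\right)$ is the Legendre symbol. A congruence modulo $M$ between power series with integer coefficients means congruence modulo $M$ of the coefficients of each power of $q$. *)

(* Defs.v *)
From HB Require Import structures.
From mathcomp Require Import all_boot all_order all_algebra.
From mathcomp Require Import boolp classical_sets.

Set Implicit Arguments.
Unset Strict Implicit.
Unset Printing Implicit Defensive.

Import GRing.Theory.
Local Open Scope ring_scope.

(* The ring R[[q]] of formal power series; [Fps u] is \sum_n u n q^n. *)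
Record fps (R : Type) := Fps { fps_coef : nat -> R }.

Lemma fpsP (R : Type) (f g : fps R) :
  (forall n, fps_coef f n = fps_coef g n) -> f = g.
Proof. by case: f g => [u] [v] /= uv; congr Fps; apply/funext. Qed.

HB.instance Definition _ (R : Type) := gen_eqMixin (fps R).
HB.instance Definition _ (R : Type) := gen_choiceMixin (fps R).

Section FpsRing.
Variable R : comNzRingType.
Implicit Types f g h : fps R.

Definition fps_zero : fps R := Fps (fun=> 0).
Definition fps_opp f : fps R := Fps (fun n => - fps_coef f n).
Definition fps_add f g : fps R := Fps (fun n => fps_coef f n + fps_coef g n).
Definition fps_one : fps R := Fps (fun n => (n == 0%N)%:R).
Definition fps_mul f g : fps R :=
  Fps (fun n => \sum_(i < n.+1) fps_coef f i * fps_coef g (n - i)).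

Fact fps_addA : associative fps_add.
Proof. by move=> f g h; apply: fpsP => n /=; rewrite addrA. Qed.
Fact fps_addC : commutative fps_add.
Proof. by move=> f g; apply: fpsP => n /=; rewrite addrC. Qed.
Fact fps_add0 : left_id fps_zero fps_add.
Proof. by move=> f; apply: fpsP => n /=; rewrite add0r. Qed.
Fact fps_addN : left_inverse fps_zero fps_opp fps_add.
Proof. by move=> f; apply: fpsP => n /=; rewrite addNr. Qed.

HB.instance Definition _ :=
  GRing.isZmodule.Build (fps R) fps_addA fps_addC fps_add0 fps_addN.

Definition fps_trunc n f : {poly R} := \poly_(i < n.+1) fps_coef f i.

Fact fps_mul_trunc n k f g : (k <= n)%N ->
  fps_coef (fps_mul f g) k = (fps_trunc n f * fps_trunc n g)`_k.
Proof.
move=> kn; rewrite coefM; apply: eq_bigr => i _; rewrite !coef_poly !ltnS.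
have ik : (i <= k)%N by rewrite -ltnS.
by rewrite (leq_trans ik kn) (leq_trans (leq_subr i k) kn).
Qed.

Fact fps_mulC : commutative fps_mul.
Proof.
by move=> f g; apply: fpsP => n; rewrite !(fps_mul_trunc _ _ (leqnn n)) mulrC.
Qed.

Fact fps_mulA : associative fps_mul.
Proof.
have aux n f g h : fps_coef (fps_mul f (fps_mul g h)) n
    = (fps_trunc n f * (fps_trunc n g * fps_trunc n h))`_n.
  rewrite coefM; apply: eq_bigr => i _.
  by rewrite (fps_mul_trunc _ _ (leq_subr i n)) coef_poly ltn_ord.
move=> f g h; apply: fpsP => n.
rewrite aux [fps_mul (fps_mul f g) h]fps_mulC aux; congr (_`_n).
by rewrite mulrA mulrC.
Qed.

Fact fps_mul1 : left_id fps_one fps_mul.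
Proof.
move=> f; apply: fpsP => n /=; rewrite big_ord_recl /= subn0 mul1r big1 ?addr0//.
by move=> i _; rewrite mul0r.
Qed.

Fact fps_mulD : left_distributive fps_mul fps_add.
Proof.
move=> f g h; apply: fpsP => n /=; rewrite -big_split; apply: eq_bigr => i _.
by rewrite /= mulrDl.
Qed.

Fact fps_one_neq0 : fps_one != 0.
Proof.
by apply/eqP => /(congr1 (fun f => fps_coef f 0)) /eqP; rewrite /= oner_eq0.
Qed.

HB.instance Definition _ := GRing.Zmodule_isComNzRing.Build (fps R)
  fps_mulA fps_mulC fps_mul1 fps_mulD fps_one_neq0.

Definition fps_unit : pred (fps R) := fun f => `[< exists g, g * f = 1 >].
(* f itself when f is not invertible, as required by unitRingType *)
Definition fps_inv f : fps R := xget f [set g | g * f = 1]%classic.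

Fact fps_mulV : {in fps_unit, left_inverse 1 fps_inv *%R}.
Proof.
move=> f /asboolP [g gf1]; rewrite /fps_inv; case: xgetP => [h -> //|no].
by case: (no g).
Qed.

Fact fps_unitPl f g : g * f = 1 -> fps_unit f.
Proof. by move=> gf1; apply/asboolP; exists g. Qed.

Fact fps_inv_out : {in [predC fps_unit], fps_inv =1 id}.
Proof.
move=> f /= /asboolP nf; rewrite /fps_inv; case: xgetP => // g _ gf1.
by case: nf; exists g.
Qed.

HB.instance Definition _ := GRing.ComNzRing_hasMulInverse.Build (fps R)
  fps_mulV fps_unitPl fps_inv_out.

Lemma fps_coefM f g n :
  fps_coef (f * g) n = \sum_(i < n.+1) fps_coef f i * fps_coef g (n - i).
Proof. by []. Qed.

Lemma fps_coef_sum I (r : seq I) (F : I -> fps R) n :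
  fps_coef (\sum_(i <- r) F i) n = \sum_(i <- r) fps_coef (F i) n.
Proof.
by elim: r => [|i r IHr]; rewrite ?big_nil // !big_cons -IHr.
Qed.

(* In particular the denominators (q;q^2)_n are genuinely invertible. *)
Lemma fps_unit1 f : fps_coef f 0 = 1 -> f \is a GRing.unit.
Proof.
move=> f0; set h := 1 - f.
have h0 : fps_coef h 0 = 0 by rewrite /= f0 subrr.
have ordh k n : (n < k)%N -> fps_coef (h ^+ k) n = 0.
  elim: k n => // k IHk n; rewrite ltnS => nk.
  rewrite exprS fps_coefM big_ord_recl h0 mul0r add0r big1 // => i _.
  rewrite IHk ?mulr0 //= /bump add1n.
  by apply: leq_trans nk; rewrite ltn_subrL (leq_ltn_trans _ (ltn_ord i)).
apply/asboolP; exists (Fps (fun n => \sum_(k < n.+1) fps_coef (h ^+ k) n)).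
apply: fpsP => n.
have -> : 1 = (\sum_(k < n.+1) h ^+ k) * f + h ^+ n.+1.
  by rewrite mulrC -[f in f * _](subKr 1) -/h -opprB mulNr -subrX1 opprB subrK.
rewrite [RHS]/= ordh // addr0 !fps_coefM.
apply: eq_bigr => i _; congr (_ * _); rewrite fps_coef_sum /=.
rewrite -!(big_mkord xpredT (fun k => fps_coef (h ^+ k) i)).
rewrite [RHS](big_cat_nat (n := i.+1)) //=.
rewrite [X in _ = _ + X]big_nat_cond [X in _ = _ + X]big1 ?addr0 //.
by move=> k /andP[/andP[ik _] _]; apply: ordh.
Qed.

(* Convergence for the q-adic topology: every coefficient is eventually
   constant. *)
Definition fps_cvg (u : nat -> fps R) (l : fps R) : Prop :=
  forall n, exists N, forall m, (N <= m)%N -> fps_coef (u m) n = fps_coef l n.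

(* 0 when u does not converge *)
Definition fps_lim (u : nat -> fps R) : fps R :=
  xget 0 [set l | fps_cvg u l]%classic.

Lemma fps_cvg_lim u l : fps_cvg u l -> fps_lim u = l.
Proof.
move=> ul; rewrite /fps_lim; case: xgetP => [l' _ ul'|no]; last by case: (no l).
apply: fpsP => n; have [N HN] := ul n; have [N' HN'] := ul' n.
by rewrite -(HN _ (leq_maxl N N')) -(HN' _ (leq_maxr N N')).
Qed.

Definition fps_series (t : nat -> fps R) : fps R :=
  fps_lim (fun N => \sum_(k < N) t k).

End FpsRing.

Definition q : fps int := Fps (fun n => (n == 1%N)%:R).

(* (b; x)_n and (b; x)_oo, for an arbitrary base x *)
Definition qpoch (b x : fps int) (n : nat) : fps int :=
  \prod_(k < n) (1 - b * x ^+ k).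

Definition qpoch_inf (b x : fps int) : fps int := fps_lim (qpoch b x).

Definition ell (k : nat) : fps int := qpoch_inf (q ^+ k) (q ^+ k).

Definition psi (x : fps int) : fps int :=
  fps_series (fun m => x ^+ (m * m.+1 %/ 2)).

Definition sigma : fps int :=
  fps_series (fun n =>
    q ^+ (n.+1 * n.+2 %/ 2) * qpoch (- q) q n / qpoch q (q ^+ 2) n.+1).

Definition P_sigma (n : nat) : int := fps_coef sigma n.

Definition fps_eqmod (M : nat) (f g : fps int) : Prop :=
  forall n, (fps_coef f n = fps_coef g n %[mod M])%Z.

Definition legendre (a : int) (p : nat) : int :=
  if (p %| a)%Z then 0
  else if [exists x : 'I_p, (x%:Z ^+ 2 == a %[mod p])%Z] then 1 else -1.

(* Main.v *)
From HB Require Import structures.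
Require Import Defs.
From mathcomp Require Import all_boot all_order all_algebra.
From mathcomp Require Import zify ring lra.

Set Implicit Arguments.
Unset Strict Implicit.
Unset Printing Implicit Defensive.

Import Order.TTheory GRing.Theory Num.Theory.
Local Open Scope ring_scope.

(** Modulo 2 the coefficients of sigma count points of an indefinite binary
    quadratic form in a cone, those of ell_2 psi(q^3) count points of a definite
    form, and a reflection argument shows that the two counts have the same
    parity.

    Write T_k = k(k+1)/2.  Modulo 2 one has (-q;q)_n = (q;q)_n, and a Bailey pair
    with beta_n = 1/(q;q^2)_(n+1) turns sigma into the Hecke-type series
    [sum_(s >= 1) q^(T_s + s^2 - s) (1 + q^s) sum_(j < s) q^(-T_j)]
    (lemmas bailey_pair, conj_sum_cong and hecke_series).  Working modulo 2 makes
    the pair elementary: its finite form is Jacobi's identity for the cube of the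
    eta product, in which the odd weights 2k+1 become 1 (finite_jacobi).
    Completing squares in the exponents, P_sigma(n) is congruent to the number of
    (f, e) with 3f^2 - e^2 = 12n - 1 and 0 < e < f (P_sigma_cone_reps).  In the
    same way Euler's pentagonal number theorem shows that the coefficient of q^N
    in ell_2 psi(q^3) is congruent to the number of positive solutions of
    2x^2 + y^2 = 24N + 11 (ell2_psi_reps).

    For n = 2N + 1 both counts concern the same integer M = 24N + 11.  They are
    compared through a third one, the number of positive solutions of
    2x^2 + 3y^2 = M.  A vector v of norm M > 0 for an integral form of signature
    (2,1) is normal to a geodesic of the hyperbolic plane.  For each of the two
    forms used here, reflections of the lattice yield the reflections in the four
    sides of a quadrilateral.  A geodesic avoiding the vertices crosses an even
    number of sides; the reflection in a side acts on the geodesics crossing that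
    side, and fixes those perpendicular to it.  Hence the number of perpendicular
    crossings of the sides has the parity of a number of passages through
    vertices (quadrilateral_law).  For 3f^2 - e^2 + 2g^2 the perpendicular
    crossings are the points of the cone above and the passages are the solutions
    of 3f^2 + 2g^2 = M (cone_reps_parity); for 2x^2 + y^2 - 6z^2 nothing is
    perpendicular, and the passages through two of the vertices are the solutions
    of 2x^2 + y^2 = M and of 2x^2 + 3z^2 = M (reps_parity).  Congruences modulo 24
    exclude all other perpendicular crossings and passages.

    It remains to study 2x^2 + y^2 at p.  As -2 is not a square modulo p, the prime
    p divides 2x^2 + y^2 only if it divides x and y.  So the count is unchanged
    when M is multiplied by p^2, which gives the first congruence by induction
    (reps_exp), and it vanishes when p divides M an odd number of times,
    which gives the second (reps_prime_mul). *)

(** * Parity of involutions *)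

(** Orbits of an involution have one or two elements, so only the fixed points
    contribute to the parity. *)
Lemma odd_count_involution (T : eqType) (S : seq T) (P : pred T) (f : T -> T) :
    uniq S ->
    (forall v, v \in S -> P v -> [/\ f v \in S, P (f v) & f (f v) = v]) ->
  odd (count P S) = odd (count (fun v => P v && (f v == v)) S).
Proof.
move=> uS fP.
suff H (s : seq T) : uniq s ->
    {in s, forall v, f v \in s} -> {in s, forall v, f (f v) = v} ->
    odd (size s) = odd (count (fun v => f v == v) s).
  rewrite -size_filter (H [seq v <- S | P v]) ?filter_uniq //.
  - rewrite count_filter; congr odd; apply: eq_count => v /=; by rewrite andbC.
  - move=> v; rewrite !mem_filter => /andP[Pv vS].
    by have [-> -> _] := fP _ vS Pv.
  - by move=> v; rewrite mem_filter => /andP[Pv vS]; have [] := fP _ vS Pv.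
have [n] := ubnP (size s); elim: n s => // n IHn [//|v s] /= szs.
move=> /andP[vs us] fs ffs.
have vv : v \in v :: s by rewrite mem_head.
have [fv|nfv] := eqVneq (f v) v.
  rewrite add1n /= (IHn s) //.
  - by move=> w ws; have := fs w; rewrite inE ws orbT inE => /(_ isT) /orP[/eqP fw|//];
      rewrite -(ffs w) ?inE ?ws ?orbT // fw fv -fw ffs ?inE ?ws ?orbT.
  - by move=> w ws; apply: ffs; rewrite inE ws orbT.
have fvs : f v \in s by have := fs v vv; rewrite inE (negPf nfv).
have us' : uniq (rem (f v) s) by rewrite rem_uniq.
have ps := perm_to_rem fvs.
rewrite (perm_size ps) (permP ps) /= ffs // eq_sym (negPf nfv) add0n negbK.
apply: IHn => //.
- by move: szs; rewrite (perm_size ps) /= ltnS => /ltnW.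
- move=> w; rewrite !mem_rem_uniq // !inE => /andP[wf ws].
  have ws' : w \in v :: s by rewrite inE ws orbT.
  have := fs w ws'; rewrite inE; case: (eqVneq (f w) v) => [fw|_ /= ->].
    by rewrite -fw ffs ?eqxx // in wf.
  rewrite andbT; apply: contra vs => /eqP/(congr1 f).
  by rewrite !ffs // => <-.
- by move=> w; rewrite mem_rem_uniq // => /andP[_ ws]; apply: ffs; rewrite inE ws orbT.
Qed.

Lemma odd_count_bigxor (T : Type) (P : pred T) (S : seq T) :
  odd (count P S) = \big[addb/false]_(v <- S) P v.
Proof. by elim: S => [|v S IHS]; rewrite ?big_nil // big_cons /= oddD IHS oddb. Qed.

Lemma odd_count_addb (T : eqType) (P P1 P2 : pred T) (S : seq T) :
  {in S, forall v, P v = P1 v (+) P2 v} ->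
  odd (count P S) = odd (count P1 S) (+) odd (count P2 S).
Proof.
move=> PE; rewrite !odd_count_bigxor -big_split big_seq [RHS]big_seq.
exact: eq_bigr.
Qed.

(** The combinatorics of a geodesic and a quadrilateral with vertices 1, 2, 3, 4:
    [a i v] tells on which side of the geodesic v the i-th vertex lies, and
    [a i v && ~~ a j v] that v, with its orientation, crosses the side ij.
    The four conditions add up to (a1 + a3)(a2 + a4) modulo 2, which does not see
    the orientation of v as long as v avoids the vertices; so the vectors v and
    [opp v] cancel, and only those through a vertex are left. *)
Lemma quadrilateral_parity (T : eqType) (S : seq T) (opp : T -> T)
    (a1 a2 a3 a4 corner : pred T) :
    uniq S -> involutive opp ->
    {in S, forall v, [/\ opp v \in S, opp v != v & corner (opp v) = corner v]} ->
    {in S, forall v, ~~ corner v ->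
      [/\ a1 (opp v) = ~~ a1 v, a2 (opp v) = ~~ a2 v,
          a3 (opp v) = ~~ a3 v & a4 (opp v) = ~~ a4 v]} ->
  odd (count (fun v => a1 v && ~~ a2 v) S)
    (+) odd (count (fun v => a3 v && ~~ a2 v) S)
    (+) odd (count (fun v => a3 v && ~~ a4 v) S)
    (+) odd (count (fun v => a1 v && ~~ a4 v) S)
  = odd (count (fun v => [&& corner v, a1 v (+) a3 v & a2 v (+) a4 v]) S).
Proof.
move=> uS oppK oppS oppa; rewrite !odd_count_bigxor -!big_split /=.
have -> : \big[addb/false]_(v <- S)
    (a1 v && ~~ a2 v (+) a3 v && ~~ a2 v (+) a3 v && ~~ a4 v (+) a1 v && ~~ a4 v)
  = \big[addb/false]_(v <- S) ((a1 v (+) a3 v) && (a2 v (+) a4 v)).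
  by apply: eq_bigr => v _; do 4![case: (_ v)].
pose W v := (a1 v (+) a3 v) && (a2 v (+) a4 v).
rewrite -[LHS]/(\big[addb/false]_(v <- S) W v).
have -> : \big[addb/false]_(v <- S) W v =
    \big[addb/false]_(v <- S) (corner v && W v)
      (+) \big[addb/false]_(v <- S) (~~ corner v && W v).
  by rewrite -big_split; apply: eq_bigr => v _ /=; case: (corner v); case: (W v).
rewrite -[X in _ (+) X]odd_count_bigxor (@odd_count_involution _ _ _ opp) //.
  have -> : count (fun v => (~~ corner v && W v) && (opp v == v)) S = 0%N.
    apply/eqP; rewrite -leqn0 leqNgt -has_count; apply/hasPn => v vS.
    by have [_ /negPf -> _] := oppS v vS; rewrite andbF.
  by rewrite addbF.
move=> v vS /andP[ncv Wv]; have [-> _ ->] := oppS v vS.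
have [e1 e2 e3 e4] := oppa v vS ncv.
split=> //; rewrite ncv /=; move: Wv; rewrite /W e1 e2 e3 e4.
by do 4![case: (_ v)].
Qed.

(** * Parity laws from reflections of a ternary form *)

Definition symrange (K : nat) : seq int := [seq i%:Z - K%:Z | i <- iota 0 (2 * K).+1].

Lemma mem_symrange (K : nat) (x : int) : (x \in symrange K) = (- K%:Z <= x <= K%:Z).
Proof.
apply/mapP/idP => [[i]|xK]; first by rewrite mem_iota => iK ->; lia.
by exists (absz (x + K%:Z)); [rewrite mem_iota; lia | lia].
Qed.

Lemma uniq_symrange (K : nat) : uniq (symrange K).
Proof. by rewrite map_inj_uniq ?iota_uniq // => i j; lia. Qed.

Definition box (K : nat) : seq (int * int * int) :=
  [seq (p, z) | p <- [seq (x, y) | x <- symrange K, y <- symrange K],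
                z <- symrange K].

Lemma mem_box (K : nat) (x y z : int) :
  ((x, y, z) \in box K) =
    [&& - K%:Z <= x <= K%:Z, - K%:Z <= y <= K%:Z & - K%:Z <= z <= K%:Z].
Proof.
rewrite -!mem_symrange andbA.
apply/allpairsPdep/idP => [[p [w [pr wr [ep ->]]]]|/andP[/andP[xr yr] zr]].
  move: pr; rewrite -ep => /allpairsPdep [a [b [ar br [-> ->]]]].
  by rewrite ar br wr.
by exists (x, y), z; split=> //; apply/allpairsPdep; exists x, y.
Qed.

Lemma uniq_box (K : nat) : uniq (box K).
Proof.
have ur := uniq_symrange K.
by apply: allpairs_uniq => [||[? ?] [? ?]] //; apply: allpairs_uniq => // -[? ?] [? ?].
Qed.

(** The reflection groups are infinite and so are the solution sets; the box is
    large enough to contain every solution whose geodesic crosses a side of the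
    polygon. *)
Definition sols (Q : int -> int -> int -> int) (M : nat) : seq (int * int * int) :=
  [seq v <- box (10 * M) | let: (x, y, z) := v in Q x y z == M%:Z].

Lemma mem_sols Q (M : nat) (x y z : int) :
  ((x, y, z) \in sols Q M) = (Q x y z == M%:Z) && ((x, y, z) \in box (10 * M)).
Proof. by rewrite mem_filter. Qed.

Lemma uniq_sols Q M : uniq (sols Q M).
Proof. by rewrite filter_uniq // uniq_box. Qed.

(** The oriented geodesics normal to v that separate the vertices dual to the
    linear forms l and l'. *)
Definition side (l l' : int -> int -> int -> int) (v : int * int * int) : bool :=
  let: (x, y, z) := v in (0 < l x y z) && ~~ (0 < l' x y z).

Definition neg3 (v : int * int * int) : int * int * int :=
  let: (x, y, z) := v in (- x, - y, - z).

(** Meant for the reflection f in a side of a polygon, which fixes the two end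
    points and hence preserves the set of geodesics that separate them. *)
Lemma count_side_reflection Q (M : nat) l l' (f : int * int * int -> int * int * int) :
    (forall x y z, Q x y z = M%:Z -> side l l' (x, y, z) ->
      [/\ (x, y, z) \in box (10 * M), side l l' (f (x, y, z)),
          f (f (x, y, z)) = (x, y, z)
        & let: (x', y', z') := f (x, y, z) in Q x' y' z' = M%:Z]) ->
  odd (count (side l l') (sols Q M)) =
  odd (count (fun v => side l l' v && (f v == v)) (sols Q M)).
Proof.
move=> fP; apply: odd_count_involution; first exact: uniq_sols.
move=> [[x y] z]; rewrite mem_sols => /andP[/eqP Qv vb] Pv.
have [_ Pf ff] := fP x y z Qv Pv.
case ef : (f (x, y, z)) => [[x' y'] z'] Qf; rewrite -ef; split=> //; rewrite ef.
by rewrite mem_sols Qf eqxx /=; have [] := fP x' y' z' Qf; rewrite -?ef.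
Qed.

Lemma count_side_reflection_free Q (M : nat) l l' (f : int * int * int -> int * int * int) :
    (forall x y z, Q x y z = M%:Z -> side l l' (x, y, z) ->
      [/\ (x, y, z) \in box (10 * M), side l l' (f (x, y, z)),
          f (f (x, y, z)) = (x, y, z)
        & let: (x', y', z') := f (x, y, z) in Q x' y' z' = M%:Z]) ->
    (forall x y z, Q x y z = M%:Z -> f (x, y, z) <> (x, y, z)) ->
  odd (count (side l l') (sols Q M)) = false.
Proof.
move=> fP nf; rewrite (count_side_reflection fP).
rewrite (@eq_in_count _ _ pred0) ?count_pred0 // => -[[x y] z].
rewrite mem_sols => /andP[/eqP Qv _].
by rewrite /= [f _ == _](introF eqP (nf _ _ _ Qv)) andbF.
Qed.

(** The values of the linear forms at v are its products, up to positive factors,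
    with the four vertices; [corner] collects the v through a vertex, at which one
    of the forms vanishes, so that its sign does not change with that of v. *)
Lemma quadrilateral_law Q (M : nat) l1 l2 l3 l4 (corner : pred (int * int * int)) :
    (forall x y z, Q (- x) (- y) (- z) = Q x y z) ->
    Q 0 0 0 <> M%:Z ->
    (forall x y z, corner (neg3 (x, y, z)) = corner (x, y, z)) ->
    (forall x y z, Q x y z = M%:Z -> ~~ corner (x, y, z) ->
      [/\ (0 < l1 (- x) (- y) (- z)) = ~~ (0 < l1 x y z),
          (0 < l2 (- x) (- y) (- z)) = ~~ (0 < l2 x y z),
          (0 < l3 (- x) (- y) (- z)) = ~~ (0 < l3 x y z)
        & (0 < l4 (- x) (- y) (- z)) = ~~ (0 < l4 x y z)]) ->
  odd (count (side l1 l2) (sols Q M)) (+) odd (count (side l3 l2) (sols Q M))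
    (+) odd (count (side l3 l4) (sols Q M)) (+) odd (count (side l1 l4) (sols Q M))
  = odd (count (fun v => corner v && let: (x, y, z) := v in
       ((0 < l1 x y z) (+) (0 < l3 x y z)) && ((0 < l2 x y z) (+) (0 < l4 x y z)))
       (sols Q M)).
Proof.
move=> QN Q0 cN lN.
pose a (l : int -> int -> int -> int) (v : int * int * int) :=
  let: (x, y, z) := v in 0 < l x y z.
have := @quadrilateral_parity _ (sols Q M) neg3 (a l1) (a l2) (a l3) (a l4) corner.
have aE l l' : (fun v => a l v && ~~ a l' v) =1 side l l' by move=> [[x y] z].
rewrite !(eq_count (aE _ _)).
move=> ->.
- by congr odd; apply: eq_count => -[[x y] z].
- exact: uniq_sols.
- by move=> [[x y] z]; rewrite /= !opprK.
- move=> [[x y] z]; rewrite mem_sols => /andP[/eqP Qv vb]; split; last exact: cN.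
  + by rewrite /= mem_sols QN Qv eqxx /=; move: vb; rewrite !mem_box; lia.
  + apply/eqP => -[hx hy hz]; apply: Q0; rewrite -Qv; congr Q; lia.
- by move=> [[x y] z]; rewrite mem_sols => /andP[/eqP Qv _] /(lN _ _ _ Qv).
Qed.

Lemma count_card (T : eqType) (S : seq T) (P : pred T) (U : finType) (A : {set U})
    (g : U -> T) :
    uniq S -> {in A &, injective g} ->
    (forall u, u \in A -> (g u \in S) && P (g u)) ->
    (forall v, v \in S -> P v -> exists2 u, u \in A & v = g u) ->
  count P S = #|A|.
Proof.
move=> uS gI gS Sg; rewrite cardE -(size_map g) -size_filter.
apply/perm_size/uniq_perm; first by rewrite filter_uniq.
  rewrite map_inj_in_uniq ?enum_uniq // => u v; rewrite !mem_enum; exact: gI.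
move=> v; rewrite mem_filter; apply/andP/mapP => [[Pv vS]|[u]].
  by have [u uA ->] := Sg v vS Pv; exists u; rewrite ?mem_enum.
by rewrite mem_enum => /gS /andP[guS Pgu] ->.
Qed.

Lemma card_bij (T U : finType) (B : {set T}) (A : {set U}) (g : U -> T) :
    {in A &, injective g} -> (forall u, u \in A -> g u \in B) ->
    (forall v, v \in B -> exists2 u, u \in A & v = g u) ->
  #|B| = #|A|.
Proof.
move=> gI gB Bg; rewrite -(card_in_imset gI); apply: eq_card => v.
apply/idP/imsetP => [/Bg //|[u uA ->]]; exact: gB.
Qed.

(** * Three binary forms with equal representation parity *)

Lemma sqr_bound (x m : int) : x * x <= m -> - m <= x <= m.
Proof. by move=> h; apply/andP; split; nia. Qed.

(** Enough to decide which of the binary forms below represent integers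
    congruent to 11 modulo 24. *)
Lemma sqr_mod24 (x : int) : exists k : int,
  x * x = 24 * k \/ x * x = 24 * k + 1 \/ x * x = 24 * k + 4 \/
  x * x = 24 * k + 9 \/ x * x = 24 * k + 12 \/ x * x = 24 * k + 16.
Proof.
have hx := divz_eq x 12; have := modz_ge0 x (isT : 12%:Z != 0).
have := ltz_pmod x (isT : (0 : int) < 12).
move: (x %/ 12)%Z (x %% 12)%Z hx => t r -> r12 r0.
exists (6 * t * t + t * r + ((r * r)%R %/ 24)%Z).
have : r = 0 \/ r = 1 \/ r = 2 \/ r = 3 \/ r = 4 \/ r = 5 \/ r = 6 \/ r = 7 \/
    r = 8 \/ r = 9 \/ r = 10 \/ r = 11 by lia.
by do 11?[case=> [->|]; first lia]; move=> ->; lia.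
Qed.

Definition reps (a b M : nat) : nat :=
  #|[set xy : 'I_M.+1 * 'I_M.+1 | [&& 0 < xy.1, 0 < xy.2 &
      a * (xy.1 * xy.1) + b * (xy.2 * xy.2) == M]%N]|.

(** The points of the hyperbola [3 f ^ 2 - e ^ 2 = M] in half of the cone
    [|e| < f], which is a fundamental domain for the action of the units of
    Z[sqrt 3] on the hyperbola. *)
Definition cone_reps (M : nat) : nat :=
  #|[set fe : 'I_M.+1 * 'I_M.+1 | [&& 0 < fe.2, fe.2 < fe.1 &
      3 * (fe.1 * fe.1) == M + fe.2 * fe.2]%N]|.

(** The law for [3 f ^ 2 - e ^ 2 + 2 g ^ 2] and the quadrilateral with vertices
    (0,1,0), (1,3,0), (2,6,3), (0,2,1) in the coordinates (f,e,g).  A geodesic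
    meets the side from (0,1,0) to (1,3,0) at a right angle when g = 0 and
    0 < e < f, and passes through the right-angled vertex (0,1,0) when e = 0. *)
Lemma cone_reps_parity (M : nat) : (M %% 24 = 11)%N ->
  odd (cone_reps M) = odd (reps 3 2 M).
Proof.
move=> M24.
pose Q (f e g : int) := 3 * (f * f) - e * e + 2 * (g * g).
pose l1 (f e g : int) := e.
pose l2 (f e g : int) := e - f.
pose l3 (f e g : int) := e - f - g.
pose l4 (f e g : int) := e - g.
pose corner (v : int * int * int) := v.1.2 == 0.
have := @quadrilateral_law Q M l1 l2 l3 l4 corner.
(* The reflection in the vector (1,1,0) of norm 2. *)
rewrite (@count_side_reflection_free Q M l3 l2 (fun v => let: (f, e, g) := v in
  (e - 2 * f, 2 * e - 3 * f, g))); first last.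
- move=> f e g; rewrite /Q => Qm [h1 h2]; have ef : e = 3 * f by lia.
  by move: Qm; rewrite ef; lia.
- move=> f e g; rewrite /Q /side /l3 /l2 => Qm ha; split; [|lia|congr (_,_,_); lia|lia].
  have hg : (f - e) * (f - e) <= g * g by nia.
  have h1 : f * f <= M%:Z by have := sqr_ge0 (2 * f - e); lia.
  have h2 : (2 * f - e) * (2 * f - e) <= M%:Z by have := sqr_ge0 f; lia.
  have b1 := sqr_bound h1; have b2 := sqr_bound h2.
  have h3 : 2 * (g * g) <= M%:Z + 2 * ((f - e) * (f - e)).
    by have := sqr_ge0 f; have := sqr_ge0 (2 * f - e); lia.
  have gb : - (9 * M%:Z) <= g by nia.
  by rewrite mem_box; lia.
(* The reflection in the vector (0,1,1) of norm 1. *)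
rewrite (@count_side_reflection_free Q M l3 l4 (fun v => let: (f, e, g) := v in
  (f, 3 * e - 4 * g, 2 * e - 3 * g))); first last.
- move=> f e g; rewrite /Q => Qm [h1 h2]; have eg : e = 2 * g by lia.
  move: Qm; rewrite eg.
  by case: (sqr_mod24 g) (sqr_mod24 f) => k hk [k' hk']; lia.
- move=> f e g; rewrite /Q /side /l3 /l4 => Qm ha; split; [|lia|congr (_,_,_); lia|lia].
  have hg : (g - e) * (g - e) <= f * f by nia.
  have h1 : f * f <= M%:Z by have := sqr_ge0 (2 * g - e); lia.
  have h2 : (2 * g - e) * (2 * g - e) <= M%:Z by have := sqr_ge0 f; lia.
  have b1 := sqr_bound h1; have b2 := sqr_bound h2.
  by rewrite mem_box; nia.
rewrite (@count_side_reflection_free Q M l1 l4 (fun v => let: (f, e, g) := v in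
  (- f, e, g))); first last.
- move=> f e g; rewrite /Q => Qm [h1]; have f0 : f = 0 by lia.
  move: Qm; rewrite f0.
  by case: (sqr_mod24 g) (sqr_mod24 e) => k hk [k' hk']; lia.
- move=> f e g; rewrite /Q /side /l1 /l4 => Qm ha; split; [|lia|by rewrite opprK|lia].
  have h1 : f * f <= M%:Z by nia.
  have h2 : g * g <= M%:Z by nia.
  have b1 := sqr_bound h1; have b2 := sqr_bound h2.
  by rewrite mem_box; nia.
rewrite (@count_side_reflection Q M l1 l2 (fun v => let: (f, e, g) := v in
  (f, e, - g))); last first.
  move=> f e g; rewrite /Q /side /l1 /l2 => Qm ha.
  rewrite mem_box; split; [|lia|by rewrite opprK|lia].
  have hf : f * f <= M%:Z by nia.
  have hg : g * g <= M%:Z by nia.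
  by have := sqr_bound hf; have := sqr_bound hg; lia.
rewrite !addbF /cone_reps /reps.
rewrite (@count_card _ _ _ _ [set fe : 'I_M.+1 * 'I_M.+1 | [&& 0 < fe.2, fe.2 < fe.1 &
      3 * (fe.1 * fe.1) == M + fe.2 * fe.2]%N] (fun fe => (fe.1%:Z, fe.2%:Z, 0))); first last.
- move=> [[f e] g]; rewrite mem_sols /Q /side /l1 /l2 => /andP[/eqP Qm vb].
  move=> /andP[ha /eqP[hg]]; have g0 : g = 0 by lia.
  move: Qm; rewrite g0 => Qm.
  have hf : f * f <= M%:Z by nia.
  have := sqr_bound hf => bf.
  have fe : f <> e by move=> fe; move: Qm; rewrite fe; lia.
  exists (inord (absz f), inord (absz e)).
    by rewrite inE /= !inordK; lia.
  by rewrite /= !inordK; first (congr (_, _, _); lia); lia.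
- move=> [[f fM] [e eM]]; rewrite inE /= mem_sols /Q /side /l1 /l2 mem_box oppr0 eqxx andbT; lia.
- move=> [f e] [f' e'] _ _ [/= hf he]; congr (_, _); exact: val_inj.
- exact: uniq_sols.
(* Of the two orientations of a geodesic through the vertex, the set on the
   right-hand side of the law retains the one with f + g < 0. *)
rewrite (@count_card _ _ _ _ [set fe : 'I_M.+1 * 'I_M.+1 | [&& 0 < fe.1, 0 < fe.2 &
      3 * (fe.1 * fe.1) + 2 * (fe.2 * fe.2) == M]%N]
   (fun fg => if (fg.2 < fg.1)%N then (- fg.1%:Z, 0, fg.2%:Z)
              else (fg.1%:Z, 0, - fg.2%:Z))); first last.
- move=> [[f e] g]; rewrite mem_sols /Q /corner /l1 /l2 /l3 /l4 /= => /andP[/eqP Qm vb].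
  move=> /andP[/eqP e0]; rewrite e0 => ha; move: Qm; rewrite e0 => Qm.
  have hf : f * f <= M%:Z by nia.
  have bf := sqr_bound hf.
  have hg : g * g <= M%:Z by nia.
  have bg := sqr_bound hg.
  exists (inord (absz f), inord (absz g)).
    by rewrite inE /= !inordK; lia.
  by rewrite /= !inordK; [|lia|lia]; case: ifP => h; congr (_, _, _); lia.
- move=> [[f fM] [g gM]]; rewrite inE /= => fgM.
  have fg : f <> g.
    by have [k hk] := sqr_mod24 f%:Z; move=> fg; move: fgM; rewrite -fg; lia.
  case: ifP => h; rewrite mem_sols mem_box /Q /corner /l1 /l2 /l3 /l4 /=; lia.
- move=> [f e] [f' e'] _ _ /=; case: ifP => h; case: ifP => h' [/= hf he];
    congr (_, _); apply: val_inj => /=; lia.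
- exact: uniq_sols.
apply.
- by move=> f e g; rewrite /Q; lia.
- by rewrite /Q; lia.
- by move=> f e g; rewrite /corner /= oppr_eq0.
- move=> f e g; rewrite /Q /corner /l1 /l2 /l3 /l4 /= => Qm e0.
  have h2 : e <> f by move=> h; move: Qm; rewrite h; lia.
  have h3 : e <> f + g.
    move=> h; have [k hk] := sqr_mod24 f; have [k' hk'] := sqr_mod24 (f - g).
    move: Qm; rewrite h; lia.
  have h4 : e <> g.
    move=> h; have [k hk] := sqr_mod24 f; have [k' hk'] := sqr_mod24 g.
    move: Qm; rewrite h; lia.
  split; lia.
Qed.

(** The law for [2 x ^ 2 + y ^ 2 - 6 z ^ 2] and the quadrilateral with vertices
    (0,0,1), (0,2,1), (1,2,1), (1,0,1), the third of which is a cusp.  A geodesic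
    passes through the right-angled vertices (0,0,1) and (0,2,1) when z = 0 and
    when y = 3 z respectively. *)
Lemma reps_parity (M : nat) : (M %% 24 = 11)%N -> odd (reps 2 1 M) = odd (reps 2 3 M).
Proof.
move=> M24.
pose Q (x y z : int) := 2 * (x * x) + y * y - 6 * (z * z).
pose l1 (x y z : int) := z.
pose l2 (x y z : int) := 3 * z - y.
pose l3 (x y z : int) := 3 * z - x - y.
pose l4 (x y z : int) := 3 * z - x.
pose corner (v : int * int * int) := (v.2 == 0) || (3 * v.2 == v.1.2).
have := @quadrilateral_law Q M l1 l2 l3 l4 corner.
rewrite (@count_side_reflection_free Q M l1 l2 (fun v => let: (x, y, z) := v in
  (- x, y, z))); first last.
- move=> x y z; rewrite /Q => Qm [h1]; have x0 : x = 0 by lia.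
  move: Qm; rewrite x0.
  by case: (sqr_mod24 y) (sqr_mod24 z) => k hk [k' hk']; lia.
- move=> x y z; rewrite /Q /side /l1 /l2 => Qm ha; split; [|lia|by rewrite opprK|lia].
  have h1 : x * x <= M%:Z by nia.
  have h2 : z * z <= M%:Z by nia.
  have h3 : y * y <= 7 * M%:Z by nia.
  have b1 := sqr_bound h1; have b2 := sqr_bound h2; have b3 := sqr_bound h3.
  by rewrite mem_box; lia.
(* The reflection in the vector (0,3,1) of norm 3. *)
rewrite (@count_side_reflection_free Q M l3 l2 (fun v => let: (x, y, z) := v in
  (x, 12 * z - 5 * y, 5 * z - 2 * y))); first last.
- move=> x y z; rewrite /Q => Qm [h1 h2]; have yz : y = 2 * z by lia.
  by move: Qm; rewrite yz; lia.
- move=> x y z; rewrite /Q /side /l3 /l2 => Qm ha; split; [|lia|congr (_,_,_); lia|lia].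
  have [u yu] : exists u, y = 3 * z + u by exists (y - 3 * z); lia.
  move: Qm ha; rewrite yu => Qm ha.
  have hx : (u + 1) * (u + 1) <= x * x by nia.
  have h1 : (z + u) * (z + u) <= M%:Z by have := sqr_ge0 (z + u); lia.
  have b1 := sqr_bound h1.
  have h2 : x * x <= M%:Z + 2 * (u * u) by have := sqr_ge0 (z + u); lia.
  have h3 : u <= M%:Z by have := sqr_ge0 (z + u); lia.
  have h4 : - x <= 4 * M%:Z by nia.
  by rewrite mem_box; lia.
(* The reflection in the vector (3,0,1) of norm 12. *)
rewrite (@count_side_reflection_free Q M l3 l4 (fun v => let: (x, y, z) := v in
  (3 * z - 2 * x, y, 2 * z - x))); first last.
- move=> x y z; rewrite /Q => Qm [h1 h2]; have xz : x = z by lia.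
  move: Qm; rewrite xz.
  by case: (sqr_mod24 y) (sqr_mod24 z) => k hk [k' hk']; lia.
- move=> x y z; rewrite /Q /side /l3 /l4 => Qm ha; split; [|lia|congr (_,_,_); lia|lia].
  have [u xu] : exists u, x = 3 * z + u by exists (x - 3 * z); lia.
  move: Qm ha; rewrite xu => Qm ha.
  have hy : (u + 1) * (u + 1) <= y * y by nia.
  have h1 : (2 * z + u) * (2 * z + u) <= M%:Z by have := sqr_ge0 (2 * z + u); lia.
  have b1 := sqr_bound h1.
  have h2 : y * y <= M%:Z + 2 * (u * u) by have := sqr_ge0 (2 * z + u); lia.
  have h3 : u <= M%:Z by have := sqr_ge0 (2 * z + u); lia.
  have h4 : - y <= 4 * M%:Z by nia.
  by rewrite mem_box; lia.
rewrite (@count_side_reflection_free Q M l1 l4 (fun v => let: (x, y, z) := v in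
  (x, - y, z))); first last.
- move=> x y z; rewrite /Q => Qm [h1]; have y0 : y = 0 by lia.
  by move: Qm; rewrite y0; lia.
- move=> x y z; rewrite /Q /side /l1 /l4 => Qm ha; split; [|lia|by rewrite opprK|lia].
  have h1 : y * y <= M%:Z by nia.
  have h2 : z * z <= M%:Z by nia.
  have h3 : x * x <= 7 * M%:Z by nia.
  have b1 := sqr_bound h1; have b2 := sqr_bound h2; have b3 := sqr_bound h3.
  by rewrite mem_box; lia.
pose W (v : int * int * int) := let: (x, y, z) := v in
  ((0 < l1 x y z) (+) (0 < l3 x y z)) && ((0 < l2 x y z) (+) (0 < l4 x y z)).
rewrite (@odd_count_addb _ _ (fun v => (v.2 == 0) && W v)
   (fun v => (3 * v.2 == v.1.2) && W v)); last first.
  move=> [[x y] z]; rewrite mem_sols => /andP[/eqP Qm _].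
  rewrite /corner /= -/(W (x, y, z)).
  have [z0|nz] := eqVneq z 0; last by [].
  have [y0|ny] := eqVneq (3 * z) y; last by rewrite addbF.
  by move: Qm; rewrite -y0 z0 /Q; lia.
rewrite /reps.
rewrite (@count_card _ _ _ _ [set xy : 'I_M.+1 * 'I_M.+1 | [&& 0 < xy.1, 0 < xy.2 &
      2 * (xy.1 * xy.1) + 1 * (xy.2 * xy.2) == M]%N]
   (fun xy => if (xy.2 < xy.1)%N then (- xy.1%:Z, xy.2%:Z, 0)
              else (xy.1%:Z, - xy.2%:Z, 0))); first last.
- move=> [[x y] z]; rewrite mem_sols /Q /W /l1 /l2 /l3 /l4 /= => /andP[/eqP Qm vb].
  move=> /andP[/eqP z0]; rewrite z0 => ha; move: Qm; rewrite z0 => Qm.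
  have hx : x * x <= M%:Z by nia.
  have bx := sqr_bound hx.
  have hy : y * y <= M%:Z by nia.
  have bY := sqr_bound hy.
  exists (inord (absz x), inord (absz y)).
    have nx : x <> 0.
      move=> x0; have [k hk] := sqr_mod24 y; move: Qm; rewrite x0; lia.
    by rewrite inE /= !inordK; lia.
  by rewrite /= !inordK; [|lia|lia]; case: ifP => h; congr (_, _, _); lia.
- move=> [[x xM] [y yM]]; rewrite inE /= => xyM.
  have xy : x <> y.
    by have [k hk] := sqr_mod24 x%:Z; move=> xy; move: xyM; rewrite -xy; lia.
  case: ifP => h; rewrite mem_sols mem_box /Q /W /l1 /l2 /l3 /l4 /=; lia.
- move=> [x y] [x' y'] _ _ /=; case: ifP => h; case: ifP => h' [/= hx hy];
    congr (_, _); apply: val_inj => /=; lia.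
- exact: uniq_sols.
rewrite (@count_card _ _ _ _ [set xy : 'I_M.+1 * 'I_M.+1 | [&& 0 < xy.1, 0 < xy.2 &
      2 * (xy.1 * xy.1) + 3 * (xy.2 * xy.2) == M]%N]
   (fun xz => if (xz.1 < 3 * xz.2)%N then (xz.1%:Z, 3 * xz.2%:Z, xz.2%:Z)
     else (- xz.1%:Z, - (3 * xz.2%:Z), - xz.2%:Z))); first last.
- move=> [[x y] z]; rewrite mem_sols /Q /W /l1 /l2 /l3 /l4 /= => /andP[/eqP Qm vb].
  move=> /andP[/eqP yz]; rewrite -yz => ha; move: Qm; rewrite -yz => Qm.
  have hx : x * x <= M%:Z by nia.
  have bx := sqr_bound hx.
  have hz : z * z <= M%:Z by nia.
  have bz := sqr_bound hz.
  exists (inord (absz x), inord (absz z)).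
    by rewrite inE /= !inordK; lia.
  by rewrite /= !inordK; [|lia|lia]; case: ifP => h; congr (_, _, _); lia.
- move=> [[x xM] [z zM]]; rewrite inE /= => xzM.
  have xz : x <> (3 * z)%N by move=> xz; move: xzM; rewrite xz; lia.
  case: ifP => h; rewrite mem_sols mem_box /Q /W /l1 /l2 /l3 /l4 /=; lia.
- move=> [x z] [x' z'] _ _ /=; case: ifP => h; case: ifP => h' [/= hx h3 hz];
    congr (_, _); apply: val_inj => /=; lia.
- exact: uniq_sols.
move=> H; apply/eqP; rewrite -[_ == _]negbK; apply/negP; rewrite negb_eqb -H ?addbF //.
- by move=> x y z; rewrite /Q; lia.
- by rewrite /Q; lia.
- by move=> x y z; rewrite /corner /= oppr_eq0; lia.
- move=> x y z; rewrite /Q /corner /l1 /l2 /l3 /l4 /= => Qm e0.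
  have h3 : y <> 3 * z - x.
    by move=> h; move: Qm; rewrite h; lia.
  have h4 : x <> 3 * z.
    move=> h; have [k hk] := sqr_mod24 y; have [k' hk'] := sqr_mod24 z.
    move: Qm; rewrite h; lia.
  split; lia.
Qed.

Lemma repsC (a b M : nat) : reps a b M = reps b a M.
Proof.
rewrite /reps -(card_imset _ (f := fun xy => (xy.2, xy.1))); last first.
  by move=> [x y] [x' y'] [-> ->].
apply: eq_card => -[x y]; rewrite inE /=; apply/imsetP/idP => [[[x' y']]|h].
  by rewrite inE /= => h [-> ->]; lia.
by exists (y, x) => //; rewrite inE /=; lia.
Qed.

(** * Primes for which -2 is a non-residue *)

Lemma legendreN2_ndvd (p : nat) : prime p -> legendre (- 2) p = - 1 ->
  forall z : nat, ~~ (p %| z * z + 2)%N.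
Proof.
move=> /prime_gt0 p0; rewrite /legendre; case: ifP => // p2; case: ifP => // nex _ z.

apply: contraFN nex => pz; apply/existsP; exists (Ordinal (ltn_pmod z p0)).
rewrite /= eqz_mod_dvd opprK.
have -> : (z %% p)%:Z ^+ 2 + 2%:Z = ((z %% p) * (z %% p) + 2)%N by rewrite PoszD PoszM.
by rewrite dvdzE /= /dvdn -modnDml modnMm modnDml.
Qed.

(** If p did not divide x, then y / x would be a square root of -2 modulo p. *)
Lemma dvdn_2sqrD (p x y : nat) : prime p ->
    (forall z : nat, ~~ (p %| z * z + 2)%N) ->
  (p %| 2 * (x * x) + y * y)%N -> (p %| x)%N && (p %| y)%N.
Proof.
move=> pp nz pxy; have [px|npx] := boolP (p %| x)%N.
  have p2x : (p %| 2 * (x * x))%N by rewrite !dvdn_mull.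
  by move: pxy; rewrite (dvdn_addr _ p2x) Euclid_dvdM // orbb.
have cpx : coprime x p by rewrite coprime_sym prime_coprime.
have x0 : (0 < x)%N by case: (x) npx; rewrite ?dvdn0.
have [u [v uv]] : exists u v, (u * x = v * p + 1)%N.
  by have [u v uv _] := egcdnP p x0; exists u, v; rewrite uv (eqP cpx).
case/negP: (nz (u * y)%N).
have : (p %| u * u * (2 * (x * x) + y * y))%N by rewrite dvdn_mull.
have -> : (u * u * (2 * (x * x) + y * y) = 2 * (u * x) * (u * x) + (u * y) * (u * y))%N by lia.
rewrite uv.
have -> : (2 * (v * p + 1) * (v * p + 1) + u * y * (u * y) =
   (2 * v * v * p + 4 * v) * p + (u * y * (u * y) + 2))%N by lia.
by rewrite dvdn_addr // dvdn_mull.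
Qed.

Lemma reps_sqrM (p m : nat) : prime p ->
    (forall z : nat, ~~ (p %| z * z + 2)%N) ->
  reps 2 1 (p ^ 2 * m) = reps 2 1 m.
Proof.
move=> pp nz; have p0 := prime_gt0 pp; rewrite /reps.
apply: (@card_bij _ _ _ _
   (fun xy : 'I_m.+1 * 'I_m.+1 => (inord (p * xy.1), inord (p * xy.2)))).
- have pb (z : 'I_m.+1) : (p * z < (p ^ 2 * m).+1)%N.
    by rewrite ltnS -mulnn -mulnA leq_pmul2l // (leq_trans _ (leq_pmull _ p0)) // -ltnS.
  move=> [x y] [x' y'] _ _ /= [/(congr1 val) /= hx /(congr1 val) /= hy].
  move: hx hy; rewrite !inordK // => /eqP; rewrite eqn_pmul2l // => /eqP hx.
  move=> /eqP; rewrite eqn_pmul2l // => /eqP hy.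
  by congr (_, _); apply: val_inj.
- have pb (z : 'I_m.+1) : (p * z < (p ^ 2 * m).+1)%N.
    by rewrite ltnS -mulnn -mulnA leq_pmul2l // (leq_trans _ (leq_pmull _ p0)) // -ltnS.
  move=> [x y]; rewrite !inE /= !inordK ?pb //.
  move=> /and3P[x0 y0 /eqP xy]; rewrite !muln_gt0 p0 x0 y0 /=; apply/eqP.
  by rewrite -[in RHS]xy -mulnn; lia.
move=> [[x xM] [y yM]]; rewrite inE /= => /and3P[x0 y0 /eqP xy].
have /andP[/dvdnP[u xE] /dvdnP[w yE]] : (p %| x)%N && (p %| y)%N.
  apply: dvdn_2sqrD => //; move: xy; rewrite mul1n => ->.
  by rewrite -mulnn -mulnA dvdn_mulr.
have uw : (2 * (u * u) + w * w = m)%N.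
  apply/eqP; rewrite -(@eqn_pmul2l (p ^ 2)) ?expn_gt0 ?p0 // -xy xE yE -mulnn.
  by apply/eqP; nia.
have um : (u < m.+1)%N by nia.
have wm : (w < m.+1)%N by nia.
exists (Ordinal um, Ordinal wm).
  by rewrite inE /=; nia.
by congr (_, _); apply: val_inj; rewrite /= inordK mulnC -?xE -?yE.
Qed.

Lemma reps_prime_mul (p m : nat) : prime p ->
    (forall z : nat, ~~ (p %| z * z + 2)%N) -> ~~ (p %| m)%N ->
  reps 2 1 (p * m) = 0%N.
Proof.
move=> pp nz pm; apply/eqP; rewrite cards_eq0; apply/eqP/setP => -[x y].
rewrite !inE /=; apply/negP => /and3P[x0 y0 /eqP xy].
have /andP[/dvdnP[u xE] /dvdnP[w yE]] : (p %| x)%N && (p %| y)%N.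
  by apply: dvdn_2sqrD => //; move: xy; rewrite mul1n => ->; rewrite dvdn_mulr.
case/negP: pm; apply/dvdnP; exists (2 * (u * u) + w * w)%N.
apply/eqP; rewrite -(@eqn_pmul2l p) ?prime_gt0 // -xy xE yE.
by apply/eqP; lia.
Qed.

Lemma reps_exp (p a m : nat) : prime p -> (forall z : nat, ~~ (p %| z * z + 2)%N) ->
  reps 2 1 (p ^ (2 * a) * m) = reps 2 1 m.
Proof.
move=> pp nz; elim: a => [|a IHa]; first by rewrite mul1n.
by rewrite mulnS expnD -mulnA reps_sqrM.
Qed.

(** Only the residues prime to 6 are left, and their squares are 1. *)
Lemma prime_sqr_mod24 (p : nat) : prime p -> (5 <= p)%N -> (p ^ 2 %% 24 = 1)%N.
Proof.
move=> pp p5.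
have p2 : ~~ (2 %| p)%N by rewrite dvdn_prime2 //; apply/eqP => h; rewrite -h in p5.
have p3 : ~~ (3 %| p)%N by rewrite dvdn_prime2 //; apply/eqP => h; rewrite -h in p5.
rewrite -modnXm; have : (p %% 24 < 24)%N by rewrite ltn_mod.
have : (p %% 24 %% 2 = p %% 2)%N by lia.
have : (p %% 24 %% 3 = p %% 3)%N by lia.
move: p2 p3; rewrite /dvdn => p2 p3.
by move: (p %% 24)%N => r; do 24?[case: r => [|r]]; lia.
Qed.

Lemma prime_exp_mod24 (p a : nat) : prime p -> (5 <= p)%N -> (p ^ (2 * a) %% 24 = 1)%N.
Proof. by move=> pp p5; rewrite expnM -modnXm prime_sqr_mod24 // exp1n. Qed.

(** * Power series modulo 2 *)

Lemma fps_coefD (R : comNzRingType) (f g : fps R) n :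
  fps_coef (f + g) n = fps_coef f n + fps_coef g n.
Proof. by []. Qed.

Lemma fps_coefN (R : comNzRingType) (f : fps R) n :
  fps_coef (- f) n = - fps_coef f n.
Proof. by []. Qed.

(** The variable over an arbitrary ring; over the integers it is [q]. *)
Definition varX (R : comNzRingType) : fps R := Fps (fun n => (n == 1%N)%:R).
Local Notation X := (varX _).

Definition mod2 (f : fps int) : fps 'F_2 := Fps (fun n => (fps_coef f n)%:~R).

Fact mod2_is_additive : zmod_morphism mod2.
Proof. by move=> f g; apply: fpsP => n; rewrite /= rmorphB. Qed.

Fact mod2_is_monoid_morphism : monoid_morphism mod2.
Proof.
split; first by apply: fpsP => n /=; case: eqP.
move=> f g; apply: fpsP => n; rewrite [LHS]/= !fps_coefM rmorph_sum.
by apply: eq_bigr => i _; rewrite rmorphM.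
Qed.

HB.instance Definition _ :=
  GRing.isZmodMorphism.Build (fps int) (fps 'F_2) mod2 mod2_is_additive.
HB.instance Definition _ :=
  GRing.isMonoidMorphism.Build (fps int) (fps 'F_2) mod2 mod2_is_monoid_morphism.

Lemma mod2_q : mod2 q = varX 'F_2.
Proof. by apply: fpsP => n /=; case: eqP. Qed.

Lemma intr_F2_eq (a b : int) : (a%:~R == b%:~R :> 'F_2) = (a == b %[mod 2])%Z.
Proof.
by rewrite -subr_eq0 -rmorphB /= eqz_mod_dvd (dvdz_pcharf (pchar_Fp _)).
Qed.

Lemma coef_mulX (R : comNzRingType) (f : fps R) n :
  fps_coef (X * f) n = if n is m.+1 then fps_coef f m else 0.
Proof.
rewrite fps_coefM big_ord_recl /= mul0r add0r; case: n => [|m]; first by rewrite big_ord0.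
rewrite big_ord_recl /= mul1r subSS subn0 big1 ?addr0 // => i _.
by rewrite /bump /= mul0r.
Qed.

Lemma coef_mulXn (R : comNzRingType) (f : fps R) k n :
  fps_coef (X ^+ k * f) n = if (n < k)%N then 0 else fps_coef f (n - k).
Proof.
elim: k n => [|k IHk] n; first by rewrite mul1r subn0.
by rewrite exprS -mulrA coef_mulX; case: n => // n; rewrite IHk ltnS subSS.
Qed.

Lemma coef_Xn (R : comNzRingType) k n : fps_coef (varX R ^+ k) n = (n == k)%:R.
Proof.
rewrite -[X ^+ k]mulr1 coef_mulXn; case: (ltnP n k) => nk.
  by rewrite ltn_eqF.
by rewrite /= subn_eq0 eqn_leq nk andbT.
Qed.

Lemma pchar_fps : 2 \in [pchar (fps 'F_2)].
Proof.
rewrite inE /= mulr2n; apply/eqP/fpsP => n /=.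
by rewrite addrr_pchar2 // pchar_Fp.
Qed.

Lemma unit_1subX (R : comNzRingType) k : 1 - varX R ^+ k.+1 \is a GRing.unit.
Proof. by apply: fps_unit1; rewrite /= coef_Xn subr0. Qed.

Lemma coef_series (t : nat -> fps int) (n L : nat) :
    (forall k m, (m <= k)%N -> fps_coef (t k.+1) m = 0) -> (n < L)%N ->
  fps_coef (fps_series t) n = fps_coef (\sum_(k < L) t k) n.
Proof.
move=> t0; have stab K m : (m < K)%N ->
    fps_coef (\sum_(k < K) t k) m = fps_coef (\sum_(k < m.+1) t k) m.
  elim: K => // K IHK mK; have [->//|nmK] := eqVneq m K.
  have mK' : (m < K)%N by lia.
  rewrite big_ord_recr fps_coefD IHK //; case: K mK' {IHK mK nmK} => // K mK.
  by rewrite /= t0 ?addr0.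
move=> nL; have -> : fps_series t = Fps (fun m => fps_coef (\sum_(k < m.+1) t k) m).
  by apply: fps_cvg_lim => m; exists m.+1 => K mK; rewrite stab.
by rewrite [RHS]stab.
Qed.

Lemma coef_qpoch_inf (b x : fps int) (n L : nat) :
    (forall k m, (m <= k)%N -> fps_coef (b * x ^+ k) m = 0) -> (n <= L)%N ->
  fps_coef (qpoch_inf b x) n = fps_coef (qpoch b x L) n.
Proof.
move=> t0; have stab K m : (m <= K)%N ->
    fps_coef (qpoch b x K) m = fps_coef (qpoch b x m) m.
  elim: K => [|K IHK] mK; first by move: mK; rewrite leqn0 => /eqP ->.
  have [->//|nmK] := eqVneq m K.+1.
  have mK' : (m <= K)%N by lia.
  have -> : qpoch b x K.+1 = qpoch b x K - qpoch b x K * (b * x ^+ K).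
    by rewrite /qpoch big_ord_recr /= mulrBr mulr1.
  rewrite fps_coefD IHK // fps_coefN.
  rewrite fps_coefM big1 ?subr0 // => i _; rewrite [X in _ * X]t0 ?mulr0 //=; lia.
move=> nL; have -> : qpoch_inf b x = Fps (fun m => fps_coef (qpoch b x m) m).
  by apply: fps_cvg_lim => m; exists m => K mK; rewrite stab.
by rewrite [RHS]stab.
Qed.

Local Notation Xq := (varX 'F_2).

Lemma unit_1subXd d k : (0 < d)%N -> 1 - (Xq ^+ d) ^+ k.+1 \is a GRing.unit.
Proof. by move=> d0; rewrite -exprM -[(d * k.+1)%N]prednK ?unit_1subX // muln_gt0 d0. Qed.

Lemma coef_sumXn (I : finType) (P : pred I) (e : I -> nat) n :
  fps_coef (\sum_(i | P i) Xq ^+ e i) n = (#|[set i | P i & e i == n]|)%:R.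
Proof.
rewrite (big_morph (fun f : fps _ => fps_coef f n) (id1 := 0) (op1 := +%R)) //.
rewrite -sum1dep_card natr_sum [RHS]big_mkcondr.
by apply: eq_bigr => i _; rewrite coef_Xn eq_sym; case: eqP.
Qed.

(** * A Bailey pair in characteristic 2 *)

Definition tri (k : nat) : nat := (k * k.+1 %/ 2)%N.

Lemma tri_S k : tri k.+1 = (tri k + k.+1)%N.
Proof. by rewrite /tri; nia. Qed.

Lemma double_tri k : (2 * tri k = k * k.+1)%N.
Proof. by elim: k => // k IHk; rewrite tri_S mulnDr IHk; lia. Qed.

Section QSeries.
Variables (R : comUnitRingType) (x : R).
Hypothesis (char2 : 2 \in [pchar R]) (unit1x : forall k, 1 - x ^+ k.+1 \is a GRing.unit).

Definition qfac (n : nat) : R := \prod_(k < n) (1 - x ^+ k.+1).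
Definition qfacV (n : nat) : R := (qfac n)^-1.
(** 1/(x;x)_(N-s), with the convention that 1/(x;x)_k = 0 for k < 0, which makes
    the recurrences hold without boundary terms. *)
Definition qfacVB (N s : nat) : R := if (s <= N)%N then qfacV (N - s) else 0.

Lemma qfac_S n : qfac n.+1 = qfac n * (1 - x ^+ n.+1).
Proof. by rewrite /qfac big_ord_recr. Qed.

Lemma qfac_unit n : qfac n \is a GRing.unit.
Proof. by elim: n => [|n IHn]; rewrite ?qfac_S ?unitrM ?IHn ?unit1x // /qfac big_ord0 unitr1. Qed.

Lemma qfacV_S n : qfacV n = (1 - x ^+ n.+1) * qfacV n.+1.
Proof.
rewrite /qfacV qfac_S invrM ?qfac_unit ?unit1x //.
by rewrite mulrA divrr ?unit1x // mul1r.
Qed.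

Lemma mul_qfacV n : qfac n * qfacV n = 1.
Proof. by rewrite divrr ?qfac_unit. Qed.

Lemma qfacVB_S N s : qfacVB N s.+1 = (1 - x ^+ (N - s)) * qfacVB N s.
Proof.
rewrite /qfacVB; case: (ltngtP s N) => [sN|sN|->]; rewrite ?mulr0 //.
  have -> : (N - s = (N - s.+1).+1)%N by lia.
  by rewrite -qfacV_S.
by rewrite subnn expr0 subrr mul0r.
Qed.

Lemma qfacVB_SS N s : qfacVB N.+1 s.+1 = qfacVB N s.
Proof. by []. Qed.

Lemma qfacVB_gt N s : (N < s)%N -> qfacVB N s = 0.
Proof. by rewrite /qfacVB; case: leqP. Qed.

(** Two steps of the Pascal rule for the Gaussian binomial coefficients
    [2n+1, n-k], divided by (x;x)_(2n+1), where n = m + 1. *)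
Lemma qfacVB_Pascal m k : (k <= m.+1)%N ->
  (1 - x ^+ (2 * m.+1)) * (1 - x ^+ (2 * m.+1).+1) * (qfacVB m.+1 k * qfacV (m.+2 + k)) =
  x ^+ (m.+1 - k) * (qfacVB m.+1 k * qfacV (m + k))
  + (1 + x ^+ (2 * m.+1)) * (qfacVB m.+1 k.+1 * qfacV (m.+1 + k))
  + x ^+ (m.+2 + k) * (qfacVB m.+1 k.+2 * qfacV (m.+2 + k)).
Proof.
move=> km; rewrite [qfacV (m + k)]qfacV_S !qfacVB_S -!addSn [qfacV (m.+1 + k)]qfacV_S -!addSn.
case: (ltngtP k m.+1) km => // [km|->] _; last first.
  rewrite subnn expr0 subrr !(mul0r, mulr0, addr0) !mul1r.
  have -> : (m.+1 + m.+1 = 2 * m.+1)%N by lia.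
  have -> : (m.+2 + m.+1 = (2 * m.+1).+1)%N by lia.
  ring.
have -> : (2 * m.+1 = (m.+1 - k.+1 + (m.+1 + k)).+1)%N by lia.
have -> : (m.+1 - k = (m.+1 - k.+1).+1)%N by lia.
rewrite [(m.+2 + k)%N]addSn !exprS exprD [(m.+1 + k)%N]addSn !exprS exprD.
ring.
Qed.

Lemma add_char2 (f : R) : f + f = 0.
Proof. exact: addrr_pchar2 char2 f. Qed.

Lemma opp_char2 (f : R) : - f = f.
Proof. exact: oppr_pchar2 char2 f. Qed.

Lemma sqr_1sub (k : nat) : (1 - x ^+ k) ^+ 2 = 1 + x ^+ (2 * k).
Proof.
have -> : (1 - x ^+ k) ^+ 2 = 1 + x ^+ k * x ^+ k - (x ^+ k + x ^+ k) by ring.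
by rewrite add_char2 subr0 -exprD addnn -mul2n.
Qed.

(** The reduction modulo 2 of the finite form of Jacobi's identity,
    [sum_k (-1)^k (2k+1) x^(T_k) [2n+1, n-k] = (x;x)_n ^ 2].  Two steps of the
    Pascal rule split the sum for n = m + 1 into [(1 + x ^ (2n))] times the sum
    for m and two shifted copies of the latter, which cancel modulo 2. *)
Lemma finite_jacobi n :
  \sum_(k < n.+1) x ^+ tri k * (qfacVB n k * qfacV (n.+1 + k)) = qfac n ^+ 2 * qfacV (2 * n).+1.
Proof.
elim: n => [|m IHm].
  rewrite big_ord_recl big_ord0 addr0 /tri expr0 mul1r /qfacVB /=.
  by rewrite {1}/qfacV /qfac !big_ord0 invr1 expr1n.
have U : (1 - x ^+ (2 * m.+1)) * (1 - x ^+ (2 * m.+1).+1) \is a GRing.unit.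
  by rewrite unitrM -[(2 * m.+1)%N]prednK ?muln_gt0 // !unit1x.
apply: (mulrI U).
have -> : (1 - x ^+ (2 * m.+1)) * (1 - x ^+ (2 * m.+1).+1) * (qfac m.+1 ^+ 2 * qfacV (2 * m.+1).+1)
   = (1 + x ^+ (2 * m.+1)) * (qfac m ^+ 2 * qfacV (2 * m).+1).
  rewrite [qfacV (2 * m).+1]qfacV_S [qfacV (2 * m).+2]qfacV_S qfac_S.
  have -> : ((2 * m).+2 = 2 * m.+1)%N by lia.
  have -> : 1 + x ^+ (2 * m.+1) = (1 - x ^+ m.+1) ^+ 2 .
    by rewrite sqr_1sub.
  ring.
rewrite -IHm.
pose b k := x ^+ tri k * (qfacVB m.+1 k.+1 * qfacV (m.+1 + k)).
have bE k : b k = x ^+ tri k * (qfacVB m k * qfacV (m.+1 + k)) by [].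
rewrite mulr_sumr (eq_bigr (fun k : 'I_m.+2 =>
   (1 + x ^+ (2 * m.+1)) * b k +
     x ^+ m.+1 * ((if k : nat is j.+1 then b j else b 0%N) + b k.+1))).
  rewrite big_split -!mulr_sumr /=.
  have b0 k : (m < k)%N -> b k = 0 by move=> mk; rewrite bE qfacVB_gt // mul0r mulr0.
  have s0 : \sum_(k < m.+2) b k = \sum_(k < m.+1) b k.
    by rewrite big_ord_recr /= b0 // addr0.
  have s1 : \sum_(k < m.+2) (if k : nat is j.+1 then b j else b 0%N) =
      b 0%N + \sum_(k < m.+1) b k by rewrite big_ord_recl.
  have s2 : b 0%N + \sum_(k < m.+2) b k.+1 = \sum_(k < m.+1) b k.
    rewrite -(big_ord_recl _ (fun k : 'I_m.+3 => b k)) big_ord_recr /= b0 //.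
    by rewrite addr0 s0.
  by rewrite big_split /= s1 s0 addrAC s2 add_char2 mulr0 addr0.
move=> k _; rewrite mulrCA qfacVB_Pascal; last by rewrite -ltnS.
have E1 : x ^+ m.+1 * b k.+1 =
    x ^+ tri k * (x ^+ (m.+2 + k) * (qfacVB m.+1 k.+2 * qfacV (m.+2 + k))) :> R.
  rewrite /b tri_S -[(m.+2 + k)%N]/((m.+1 + k).+1) -[(m.+1 + k).+1]addnS.
  by rewrite !exprD; ring.
have E0 : x ^+ m.+1 * (if k : nat is j.+1 then b j else b 0%N) =
    x ^+ tri k * (x ^+ (m.+1 - k) * (qfacVB m.+1 k * qfacV (m + k))).
  case: k {E1} => -[|j] jm /=.
    have r1 : qfacVB m.+1 1 = qfacV m by rewrite qfacVB_SS /qfacVB subn0.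
    have r0 : qfacVB m.+1 0 = qfacV m.+1 by rewrite /qfacVB subn0.
    by rewrite /b r0 r1 subn0 !addn0; ring.
  have ->: (m + j.+1 = m.+1 + j)%N by lia.
  have -> : (m.+1 - j.+1 = m - j)%N by lia.
  have -> : x ^+ m.+1 = x ^+ (m - j) * x ^+ j.+1 by rewrite -exprD; congr (x ^+ _); lia.
  by rewrite /b tri_S exprD; ring.
rewrite [in RHS]mulrDr E0 E1 /b; ring.
Qed.

(** Splitting (x;x)_(2n+1) into odd and even powers; modulo 2 the even factors
    1 - x^(2k) are squares. *)
Lemma odd_factors n :
  (\prod_(k < n.+1) (1 - x * (x ^+ 2) ^+ k)) * qfac n ^+ 2 = qfac (2 * n).+1.
Proof.
elim: n => [|n IHn].
  by rewrite big_ord_recl big_ord0 /qfac big_ord0 big_ord_recl big_ord0 expr0 expr1 expr1n !mulr1.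
rewrite big_ord_recr /= [qfac n.+1]qfac_S [(qfac n * _) ^+ 2]exprMn.
rewrite sqr_1sub mulrACA IHn -exprM -exprS.
have -> : (2 * n.+1 = (2 * n).+2)%N by lia.
have -> : 1 + x ^+ (2 * n).+2 = 1 - x ^+ (2 * n).+2 by rewrite opp_char2.
by rewrite !qfac_S; ring.
Qed.

Lemma odd_factorsV n :
  (\prod_(k < n.+1) (1 - x * (x ^+ 2) ^+ k))^-1 = qfac n ^+ 2 * qfacV (2 * n).+1.
Proof.
have := odd_factors n; set P := \prod_(k < _) _ => PE.
have PU : P \is a GRing.unit.
  by have := qfac_unit (2 * n).+1; rewrite -PE unitrM => /andP[].
by apply: (mulrI PU); rewrite divrr // mulrA PE mul_qfacV.
Qed.

(** The kernel that relates the two halves of a Bailey pair: up to a constant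
    factor the one for the base point x^2, both indices being shifted by 1. *)
Definition kern (N s : nat) := qfacVB N s * qfacV (N + s).

Lemma kern_gt N s : (N < s)%N -> kern N s = 0.
Proof. by move=> Ns; rewrite /kern qfacVB_gt // mul0r. Qed.

Lemma kern_step N s : (1 - x ^+ (N + s).+1) * kern N s.+1 = (1 - x ^+ (N - s)) * kern N s.
Proof. by rewrite /kern addnS mulrCA -qfacV_S qfacVB_S mulrA. Qed.

(** Removes the factor x^(N+s), which mixes the two indices: by [kern_step] the
    left-hand side at s minus its value at s + 1 is the term t = s of the sum. *)
Lemma kern_telescope (N L j s : nat) : (N <= L)%N -> (j < s <= L.+1)%N ->
  x ^+ (s * s - s - tri j) * ((1 - x ^+ (N + s)) * kern N s) =
  \sum_(s <= t < L.+1) x ^+ (t * t - t - tri j) * (1 - x ^+ (2 * t)) * kern N t.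
Proof.
move=> NL /andP[js sL]; have T2j := double_tri j.
have [d dE] : exists d, (L.+1 = s + d)%N by exists (L.+1 - s)%N; lia.
elim: d s js sL dE => [|d IHd] s js sL dE.
  by rewrite big_geq ?kern_gt ?mulr0 //; lia.
rewrite big_ltn ?dE -?dE; last by lia.
rewrite -IHd; try lia.
have -> : (s.+1 * s.+1 - s.+1 - tri j = s * s - s - tri j + 2 * s)%N by nia.
rewrite addnS kern_step [x ^+ (_ + 2 * s)]exprD.
have [Ns|sN] := ltnP N s; first by rewrite kern_gt //; ring.
have -> : (N + s = N - s + 2 * s)%N by lia.
by rewrite exprD; ring.
Qed.

Lemma sum_widen (n L : nat) (f : nat -> R) : (n <= L)%N ->
  (forall k, (n <= k)%N -> f k = 0) -> \sum_(k < L) f k = \sum_(k < n) f k.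
Proof.
move=> nL f0; rewrite -!(big_mkord xpredT) (@big_cat_nat _ _ _ n) //=.
by rewrite [X in _ + X]big_nat_cond [X in _ + X]big1 ?addr0 // => k /andP[/andP[/f0]].
Qed.

(** Together with the factor 1 - x^(2(t+1)), the member alpha of the Bailey pair;
    L only bounds the summation. *)
Definition hecke_row (L t : nat) : R := \sum_(j < L | (j <= t)%N) x ^+ (t.+1 * t - tri j).

(** Each summand of [finite_jacobi] carries a factor 1 - x^(N+s) hidden in
    [qfacV]; [kern_telescope] expands it, and the sums are exchanged. *)
Lemma bailey_pair (n L : nat) : (n < L)%N ->
  qfac n ^+ 2 * qfacV (2 * n).+1 =
  \sum_(t < L) (1 - x ^+ (2 * t.+1)) * hecke_row L t * kern n.+1 t.+1.
Proof.
move=> nL; rewrite -finite_jacobi.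
rewrite -(@sum_widen n.+1 L (fun k => x ^+ tri k * (qfacVB n k * qfacV (n.+1 + k)))) //;
  last by move=> k nk; rewrite qfacVB_gt ?mul0r ?mulr0.
transitivity (\sum_(j < L) \sum_(t < L | (j <= t)%N)
   x ^+ (t.+1 * t - tri j) * (1 - x ^+ (2 * t.+1)) * kern n.+1 t.+1).
  apply: eq_bigr => j _.
  have jL := ltn_ord j.
  have := @kern_telescope n.+1 L j j.+1 nL; rewrite ltnSn ltnS ltnW // => /(_ isT).
  rewrite big_add1 big_geq_mkord /=.
  have -> : (j.+1 * j.+1 - j.+1 - tri j = tri j)%N by have := double_tri j; lia.
  rewrite {1}/kern qfacVB_SS addnS [(1 - _) * (_ * _)]mulrCA -qfacV_S => ->.
  by apply: eq_bigr => t _; congr (x ^+ _ * _ * _); lia.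
rewrite (exchange_big_dep xpredT) //=; apply: eq_bigr => t _.
by rewrite -!mulr_suml /hecke_row [_ * (1 - _)]mulrC.
Qed.

(** Partial sums of the conjugate Bailey pair attached to the weights
    x^(T_(n+1)) (x;x)_n of sigma modulo 2. *)
Definition conj_sum (L s : nat) := \sum_(n < L) x ^+ tri n.+1 * qfac n * kern n.+1 s.

(** A creative telescoping certificate: the recurrence in s of the summand is a
    difference in n, since [qfacVB n s] is [qfacVB n.+1 s.+1]. *)
Lemma conj_sum_summand n s :
  (1 + x ^+ s.+1) * (x ^+ tri n.+1 * qfac n * kern n.+1 s.+1)
  + x ^+ s.+1 * (1 + x ^+ s) * (x ^+ tri n.+1 * qfac n * kern n.+1 s) =
  (1 + x ^+ (2 * s).+1) * (x ^+ tri n.+2 * qfac n.+1 * (qfacVB n.+1 s * qfacV (n.+2 + s))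
    + x ^+ tri n.+1 * qfac n * (qfacVB n s * qfacV (n.+1 + s))).
Proof.
rewrite /kern -[qfacVB n s]qfacVB_SS qfacVB_S [qfacV (n.+1 + s)]qfacV_S addnS -!addSn.
rewrite qfac_S [tri n.+2]tri_S.
have [sN|Ns] := leqP s n.+1; last by rewrite qfacVB_gt //; ring.
have E : x ^+ n.+1 = x ^+ (n.+1 - s) * x ^+ s by rewrite -exprD subnK.
have -> : x ^+ (n.+2 + s) = x * x ^+ (n.+1 - s) * x ^+ s * x ^+ s.
  by rewrite addSn exprS exprD E; ring.
rewrite [x ^+ (tri n.+1 + _)]exprD [x ^+ n.+2]exprS E ![x ^+ s.+1]exprS.
rewrite [x ^+ (2 * s).+1]exprS mul2n -addnn exprD.
set u := x ^+ (n.+1 - s); set v := x ^+ s.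
set c := x ^+ tri n.+1; set r := qfacVB n.+1 s; set i := qfacV (n.+2 + s).
(* The two sides differ by twice a multiple of w. *)
pose w := x * v - x * u * v + x * u * v * v - x * x * u * v * v * v.
apply/subr0_eq; transitivity (c * qfac n * r * i * (w + w)).
  by rewrite /w; ring.
by rewrite add_char2 mulr0.
Qed.

Lemma conj_sum_S L s : conj_sum L.+1 s = conj_sum L s + x ^+ tri L.+1 * qfac L * kern L.+1 s.
Proof. by rewrite /conj_sum big_ord_recr. Qed.

Lemma conj_sum_step (L s : nat) : (0 < s)%N ->
  (1 + x ^+ s.+1) * conj_sum L s.+1 + x ^+ s.+1 * (1 + x ^+ s) * conj_sum L s =
  x ^+ tri L.+1 * ((1 + x ^+ (2 * s).+1) * qfac L * (qfacVB L s * qfacV (L.+1 + s))).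
Proof.
move=> s0; elim: L => [|L IHL].
  by rewrite /conj_sum !big_ord0 [qfacVB 0 s]qfacVB_gt //; ring.
rewrite !conj_sum_S [_ * (conj_sum L s.+1 + _)]mulrDr [_ * (conj_sum L s + _)]mulrDr addrACA IHL.
rewrite conj_sum_summand.
apply/subr0_eq.
set c := x ^+ tri L.+1 * ((1 + x ^+ (2 * s).+1) * qfac L * (qfacVB L s * qfacV (L.+1 + s))).
by transitivity (c + c); [rewrite /c; ring | rewrite add_char2].
Qed.

Lemma conj_sum_1 (L : nat) : (1 + x) * conj_sum L 1 = x + x ^+ tri L.+1 * ((1 + x) * qfacV L.+1).
Proof.
elim: L => [|L IHL].
  rewrite /conj_sum big_ord0 mulr0 (_ : tri 1 = 1%N) // expr1 /qfacV /qfac big_ord1 expr1.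
  have -> : 1 + x = 1 - x by rewrite opp_char2.
  by rewrite divrr ?mulr1 ?add_char2 // -[x]expr1 unit1x.
rewrite conj_sum_S mulrDr IHL /kern qfacVB_SS [qfacV L.+1]qfacV_S.
have -> : qfacVB L 0 = qfacV L by rewrite /qfacVB subn0.
rewrite -[_ * qfac L * _]mulrA [qfac L * _]mulrA mul_qfacV mul1r addn1 [tri L.+2]tri_S exprD.
apply/subr0_eq; transitivity (x ^+ tri L.+1 * ((1 + x) * qfacV L.+2)
   + x ^+ tri L.+1 * ((1 + x) * qfacV L.+2)
   - 2 * (x ^+ tri L.+1 * x ^+ L.+2 * (1 + x) * qfacV L.+2)).
  by ring.
have -> : (2 : R) = 0 by exact: add_char2 1.
by rewrite add_char2 mul0r subr0.
Qed.

(** Congruence modulo the ideal generated by x ^ K, which replaces convergence in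
    this section. *)
Definition cong_pow (K : nat) (f g : R) := exists h, f = g + x ^+ K * h.

Lemma leq_tri k : (k <= tri k)%N.
Proof. by case: k => // k; rewrite tri_S leq_addl. Qed.

(** In the limit, conj_sum at s is x^(T_s)/(1 + x^s): both sides obey the same
    recurrence in s, the boundary term of [conj_sum_step] being divisible by
    x^(T_(L+1)). *)
Lemma conj_sum_cong (L s : nat) : cong_pow L.+1 ((1 + x ^+ s.+1) * conj_sum L s.+1) (x ^+ tri s.+1).
Proof.
have TL : x ^+ tri L.+1 = x ^+ L.+1 * x ^+ (tri L.+1 - L.+1) by rewrite -exprD subnKC ?leq_tri.
elim: s => [|s [h hE]].
  exists (x ^+ (tri L.+1 - L.+1) * ((1 + x) * qfacV L.+1)).
  by rewrite (_ : tri 1 = 1%N) // expr1 conj_sum_1 TL -mulrA.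
have := conj_sum_step L (ltn0Sn s); rewrite -[x ^+ _ * _ * _]mulrA hE => /eqP.
rewrite -[_ == _]subr_eq0 -addrA addr_eq0 => /eqP ->.
set r := (1 + _) * _ * _; exists (x ^+ s.+2 * h - x ^+ (tri L.+1 - L.+1) * r).
by rewrite TL [tri s.+2]tri_S exprD [LHS]opp_char2; ring.
Qed.

(** Inserting the Bailey pair in the series of sigma and exchanging summations;
    one of the two factors 1 + x^(t+1) of 1 - x^(2(t+1)) cancels the denominator
    of the conjugate pair. *)
Lemma hecke_series (L : nat) : cong_pow L.+1
  (\sum_(n < L) x ^+ tri n.+1 * qfac n * (qfac n ^+ 2 * qfacV (2 * n).+1))
  (\sum_(t < L) (1 + x ^+ t.+1) * hecke_row L t * x ^+ tri t.+1).
Proof.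
have -> : \sum_(n < L) x ^+ tri n.+1 * qfac n * (qfac n ^+ 2 * qfacV (2 * n).+1)
  = \sum_(t < L) (1 + x ^+ t.+1) * hecke_row L t * ((1 + x ^+ t.+1) * conj_sum L t.+1).
  rewrite (eq_bigr (fun n : 'I_L => \sum_(t < L) (1 - x ^+ (2 * t.+1)) * hecke_row L t *
      (x ^+ tri n.+1 * qfac n * kern n.+1 t.+1))); last first.
    move=> n _; rewrite (bailey_pair (ltn_ord n)) mulr_sumr; apply: eq_bigr => t _.
    by rewrite mulrCA.
  rewrite exchange_big /=; apply: eq_bigr => t _; rewrite -mulr_sumr -/(conj_sum L t.+1).
  by rewrite opp_char2 -sqr_1sub opp_char2; ring.
have /fin_all_exists[h hE] : forall t : 'I_L, exists h,
    (1 + x ^+ t.+1) * conj_sum L t.+1 = x ^+ tri t.+1 + x ^+ L.+1 * h.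
  by move=> t; exact: conj_sum_cong.
exists (\sum_(t < L) (1 + x ^+ t.+1) * hecke_row L t * h t).
rewrite mulr_sumr -big_split /=; apply: eq_bigr => t _.
by rewrite hE; ring.
Qed.

(** * Euler's pentagonal series in characteristic 2 *)

(** Shanks' finite form of Euler's identity: passing from m to m + 1, all terms of
    the difference but two cancel in pairs. *)
Lemma shanks m :
  \sum_(s < m.+1) qfac m * qfacV s * x ^+ (s * m + tri s) =
  1 + \sum_(k < m) (x ^+ (k.+1 * k.+1 + tri k) + x ^+ (k.+1 * k.+1 + tri k.+1)).
Proof.
elim: m => [|m IHm].
  by rewrite big_ord1 big_ord0 addr0 mul_qfacV mul1r.
rewrite [in RHS]big_ord_recr addrA -IHm big_ord_recr /= mul_qfacV mul1r.
pose y s := qfac m * qfacV s * x ^+ (s.+1 * m.+1 + tri s).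
have E (s : 'I_m.+1) : true -> qfac m.+1 * qfacV s * x ^+ (s * m.+1 + tri s) =
    qfac m * qfacV s * x ^+ (s * m + tri s)
    - (qfac m * (qfacV s * (1 - x ^+ s)) * x ^+ (s * m + tri s) + y s).
  move=> _; rewrite /y qfac_S.
  have -> : (s * m.+1 + tri s = s + (s * m + tri s))%N by rewrite mulnS addnA.
  have -> : (s.+1 * m.+1 + tri s = s + m.+1 + (s * m + tri s))%N by lia.
  by rewrite !exprD; ring.
rewrite (eq_bigr _ E) sumrB big_split /=.
rewrite [X in _ - (X + _)]big_ord_recl /= subrr !mulr0 mul0r add0r.
have -> : \sum_(i < m) qfac m * (qfacV (lift ord0 i) * (1 - x ^+ lift ord0 i)) *
    x ^+ (lift ord0 i * m + tri (lift ord0 i)) = \sum_(i < m) y i.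
  apply: eq_bigr => i _; rewrite /= /bump add1n mulrC [qfacV _ * _]mulrC -qfacV_S mulrC.
  by congr (_ * x ^+ _); rewrite tri_S; lia.
have -> : \sum_(i < m) y i + \sum_(i < m.+1) y i = y m.
  by rewrite big_ord_recr /= addrA add_char2 add0r.
by rewrite /y mul_qfacV mul1r opp_char2 -addrA.
Qed.

(** The term s = 0 of [shanks] is (x;x)_m and the other ones are divisible by
    x^(m+1). *)
Lemma pentagonal m : cong_pow m.+1 (qfac m)
  (1 + \sum_(k < m) (x ^+ (k.+1 * k.+1 + tri k) + x ^+ (k.+1 * k.+1 + tri k.+1))).
Proof.
rewrite -shanks big_ord_recl /= addn0 mulr1.
exists (\sum_(s < m) qfac m * qfacV s.+1 * x ^+ (s * m + s + tri s)).
have -> : qfac m * qfacV 0 = qfac m by rewrite /qfacV [qfac 0]big_ord0 invr1 mulr1.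
rewrite mulr_sumr -[LHS]addr0 -addrA; congr (_ + _).
rewrite -big_split big1 //= => s _; rewrite /bump add1n.
have -> : (s.+1 * m + tri s.+1 = m.+1 + (s * m + s + tri s))%N by rewrite tri_S; lia.
by rewrite exprD mulrCA add_char2.
Qed.
End QSeries.

(** * Coefficients modulo 2 as numbers of representations *)

Lemma cong_pow_coef (x : fps 'F_2) d K f g n : x = Xq ^+ d -> cong_pow x K f g -> (n < d * K)%N ->
  fps_coef f n = fps_coef g n.
Proof.
move=> -> [h ->] nK; rewrite fps_coefD -exprM coef_mulXn ifT ?addr0 //.
Qed.

Lemma mod2_qpochN (n : nat) : mod2 (qpoch (- q) q n) = qfac Xq n.
Proof.
rewrite rmorph_prod; apply: eq_bigr => k _.
by rewrite mulNr opprK -exprS rmorphD rmorph1 rmorphXn /= mod2_q (@opp_char2 _ pchar_fps).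
Qed.

Lemma mod2_qpoch_odd n : mod2 (qpoch q (q ^+ 2) n.+1)^-1 = qfac Xq n ^+ 2 * qfacV Xq (2 * n).+1.
Proof.
rewrite rmorphV; last first.
  apply: rpred_prod => k _; rewrite -exprM -exprS; exact: (unit_1subX int).
rewrite -odd_factorsV; [|exact: pchar_fps|exact: unit_1subX].
rewrite rmorph_prod; congr _^-1; apply: eq_bigr => k _.
by rewrite rmorphB rmorph1 rmorphM !rmorphXn /= mod2_q.
Qed.

Lemma P_sigma_hecke n : (P_sigma n)%:~R =
  fps_coef (\sum_(t < n.+1) (1 + Xq ^+ t.+1) * hecke_row Xq n.+1 t * Xq ^+ tri t.+1) n :> 'F_2.
Proof.
rewrite -(@cong_pow_coef Xq 1 n.+2 _ _ _ (esym (expr1 _))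
  (hecke_series pchar_fps (unit_1subX _) n.+1)); last by lia.
rewrite /P_sigma /sigma (@coef_series _ _ n.+1) //; last first.
  move=> k m mk; rewrite -mulrA coef_mulXn ifT //.
  by have := leq_tri k.+2; rewrite /tri; lia.
rewrite -[LHS]/(fps_coef (mod2 _) n) rmorph_sum; congr (fps_coef _ n).
apply: eq_bigr => k _; rewrite rmorphM rmorphM rmorphXn /= mod2_q mod2_qpochN.
by rewrite mod2_qpoch_odd.
Qed.

(** Completing squares in the exponents of the Hecke-type series; b selects a term
    of the factor 1 + x^(t+1). *)
Lemma cone_change_of_variables (t j n : nat) (b : bool) : (j <= t)%N ->
    (t.+1 * t - tri j + tri t.+1 + (if b then t.+1 else 0))%N = n ->
  let f := (3 * t + 2 + b - j)%N in let e := (3 * (t - j) + 1 + b)%N in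
  [/\ (e = f - (2 * j).+1)%N, (f < (12 * n - 1).+1)%N, (0 < e)%N, (e < f)%N
     & (3 * (f * f) = 12 * n - 1 + e * e)%N].
Proof.
move=> jt ne f e; have [d tE] : exists d, t = (j + d)%N by exists (t - j)%N; lia.
have T1 := double_tri j; have T3 := double_tri t; have T4 := tri_S t.
have fE : f = (2 * j + 3 * d + 2 + b)%N by rewrite /f tE; lia.
have eE : e = (3 * d + 1 + b)%N by rewrite /e tE; lia.
have Tj : (tri j <= t.+1 * t)%N.
  have : (j * j.+1 <= t.+1 * t)%N by rewrite mulnC leq_mul.
  lia.
have n2 : (2 * n + j * j.+1 = 3 * (t * t.+1) + 2 * t.+1 + 2 * (b * t.+1))%N.
  by rewrite -T1 -T3 -ne T4; case: (b) => /=; lia.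
have main : (3 * (f * f) + 1 = 12 * n + e * e)%N.
  by rewrite fE eE; move: n2; rewrite tE; case: (b) => /=; lia.
have e0 : (0 < e)%N by lia.
have ef : (e < f)%N by lia.
have ff : (f <= f * f)%N by rewrite leq_pmulr // (ltn_trans e0).
have ee : (e * e <= f * f)%N by rewrite leq_mul // ltnW.
by split; lia.
Qed.

Lemma P_sigma_cone_reps n : (0 < n)%N ->
  (P_sigma n)%:~R = (cone_reps (12 * n - 1))%:R :> 'F_2.
Proof.
move=> n0; rewrite P_sigma_hecke.
pose e (u : 'I_n.+1 * 'I_n.+1 * bool) := 
  (u.1.1.+1 * u.1.1 - tri u.1.2 + tri u.1.1.+1 + (if u.2 then u.1.1.+1 else 0))%N.
have -> : \sum_(t < n.+1) (1 + Xq ^+ t.+1) * hecke_row Xq n.+1 t * Xq ^+ tri t.+1 =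
    \sum_(u : 'I_n.+1 * 'I_n.+1 * bool | (u.1.2 <= u.1.1)%N) Xq ^+ e u.
  transitivity (\sum_(t < n.+1) \sum_(j < n.+1 | (j <= t)%N)
      \sum_(b : bool) Xq ^+ e (t, j, b)); last first.
    rewrite pair_big_dep pair_big_dep.
    by apply: eq_big => [[[t j] b]|[[t j] b] _] /=; rewrite ?andbT.
  apply: eq_bigr => t _; rewrite -mulrA mulrCA mulr_suml; apply: eq_bigr => j _.
  by rewrite big_bool /e /= addn0 !exprD; ring.
rewrite coef_sumXn; congr (_%:R); apply: esym.
apply: (@card_bij _ _ _ _ (fun u : 'I_n.+1 * 'I_n.+1 * bool =>
  (inord (3 * u.1.1 + 2 + u.2 - u.1.2), inord (3 * (u.1.1 - u.1.2) + 1 + u.2)))).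
- move=> [[[t tn] [j jn]] b] [[[t' tn'] [j' jn']] b']; rewrite !inE /e /=.
  move=> /andP[jt /eqP ne] /andP[jt' /eqP ne'] [].
  have [h1 h2 h3 h4 _] := cone_change_of_variables jt ne.
  have [h1' h2' h3' h4' _] := cone_change_of_variables jt' ne'.
  move=> /(congr1 val) /= hf /(congr1 val) /= he.
  rewrite !inordK // in hf; rewrite !inordK in he; try lia.
  have jj : j = j' by lia.
  have bb : b = b' by case: (b) (b') hf he {ne ne' h1 h2 h3 h4 h1' h2' h3' h4'} => -[]; lia.
  have tt' : t = t' by move: hf he; rewrite bb jj; lia.
  by rewrite bb; congr (_, _, _); apply: val_inj.
- move=> [[[t tn] [j jn]] b]; rewrite !inE /e /= => /andP[jt /eqP ne].
  have [h1 h2 h3 h4 h5] := cone_change_of_variables jt ne.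
  by rewrite !inordK ?h3 ?h4 ?h5 ?eqxx //; lia.
move=> [[f fM] [e' eM]]; rewrite inE /= => /and3P[e0 ef /eqP fe].
have [j fE] : exists j, f = (e' + (2 * j).+1)%N.
  exists ((f - e') %/ 2)%N.
  have [w fw] : exists w, f = (e' + w)%N by exists (f - e')%N; lia.
  have : (w %% 2 = 1)%N.
    have [k [wE|->]] : exists k, w = (2 * k)%N \/ w = (2 * k).+1 by exists (w %/ 2)%N; lia.
      by move: fe; rewrite fw wE; lia.
    lia.
  by rewrite fw; lia.
have [d [b eE]] : exists d (b : bool), e' = (3 * d + 1 + b)%N.
  have [d] : exists d, e' = (3 * d)%N \/ e' = (3 * d + 1)%N \/ e' = (3 * d + 2)%N.
    by exists (e' %/ 3)%N; lia.
  case=> [h|[->|->]]; [|by exists d, false; lia|by exists d, true; lia].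
  by move: fe; rewrite fE h; lia.
have T1 := double_tri j; have T3 := double_tri (j + d); have T4 := tri_S (j + d).
have Tj : (tri j <= (j + d).+1 * (j + d))%N.
  have : (j * j.+1 <= (j + d).+1 * (j + d))%N by rewrite mulnC leq_mul //; lia.
  lia.
have ne : ((j + d).+1 * (j + d) - tri j + tri (j + d).+1 + (if b then (j + d).+1 else 0))%N = n.
  by move: fe; rewrite fE eE T4; case: (b) => /=; lia.
have tn : (j + d < n.+1)%N by have := leq_tri (j + d).+1; lia.
have jn : (j < n.+1)%N by lia.
exists (Ordinal tn, Ordinal jn, b); first by rewrite inE /e /= ne eqxx; lia.
by congr (_, _); apply: val_inj => /=; rewrite inordK; lia.
Qed.

Lemma coef_ell2 (N n : nat) : (n <= N)%N ->
  (fps_coef (ell 2) n)%:~R = fps_coef (qfac (Xq ^+ 2) N) n.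
Proof.
move=> nN; rewrite /ell.
have ord k m : (m <= k)%N -> fps_coef (q ^+ 2 * (q ^+ 2) ^+ k) m = 0.
  by move=> mk; rewrite -exprM -exprD coef_Xn; case: eqP => //; lia.
have -> : fps_coef (qpoch_inf (q ^+ 2) (q ^+ 2)) n = fps_coef (qpoch (q ^+ 2) (q ^+ 2) N) n.
  exact: coef_qpoch_inf.
rewrite -[LHS]/(fps_coef (mod2 _) n) rmorph_prod; congr (fps_coef _ n).
by apply: eq_bigr => k _; rewrite -exprS rmorphB rmorph1 !rmorphXn /= mod2_q.
Qed.

Lemma coef_psi3 (L n : nat) : (n < L)%N ->
  (fps_coef (psi (q ^+ 3)) n)%:~R = fps_coef (\sum_(i < L) Xq ^+ (3 * tri i)) n.
Proof.
move=> nL; rewrite /psi (@coef_series _ _ L) //; last first.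
  move=> k m mk; rewrite -exprM coef_Xn -/(tri k.+1).
  by have := leq_tri k.+1; case: eqP => //; lia.
rewrite -[LHS]/(fps_coef (mod2 _) n) rmorph_sum; congr (fps_coef _ n).
by apply: eq_bigr => k _; rewrite -exprM rmorphXn /= mod2_q.
Qed.

(** The two families of pentagonal numbers become one sum over (k, b), in which
    the constant term 1 has index (0, true). *)
Lemma pentagonal_index (L : nat) :
  1 + \sum_(k < L) ((Xq ^+ 2) ^+ (k.+1 * k.+1 + tri k) + (Xq ^+ 2) ^+ (k.+1 * k.+1 + tri k.+1)) =
  \sum_(u : 'I_L.+1 * bool | u.2 || (0 < u.1)%N)
     Xq ^+ (2 * (u.1 * u.1 + tri (if u.2 then u.1 : nat else u.1.-1))).
Proof.
transitivity (\sum_(k < L.+1) \sum_(b : bool | b || (0 < k)%N)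
     Xq ^+ (2 * (k * k + tri (if b then k : nat else k.-1)))); last first.
  by rewrite pair_big_dep.
rewrite big_ord_recl /=; congr (_ + _).
  by rewrite big_mkcond big_bool /= addr0.
apply: eq_bigr => k _; rewrite big_mkcond big_bool /bump /= !add1n -!exprM.
by rewrite [LHS]addrC [(0 + k)%N]add0n.
Qed.

(** Completing squares: [a] runs over the positive integers prime to 6 and [c]
    over the odd multiples of 3. *)
Lemma pentagonal_change_of_variables (k i N : nat) (b : bool) : b || (0 < k)%N ->
    (2 * (k * k + tri (if b then k else k.-1)) + 3 * tri i)%N = N ->
  let a := (if b then 6 * k + 1 else 6 * k - 1)%N in let c := (3 * (2 * i + 1))%N in
  [/\ (0 < a)%N, (0 < c)%N, (a < (24 * N + 11).+1)%N, (c < (24 * N + 11).+1)%N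
     & (2 * (a * a) + 1 * (c * c) = 24 * N + 11)%N].
Proof.
move=> kb ne a c; have Ti := double_tri i.
have main : (0 < a)%N /\ (2 * (a * a) + 1 * (c * c) = 24 * N + 11)%N.
  rewrite /a /c; case: (b) kb ne => /= [_|].
    by have Tk := double_tri k; lia.
  by case: (k) => // m _ /=; have Tm := double_tri m; lia.
have [a0 ac] := main; have c0 : (0 < c)%N by rewrite /c; lia.
have aa : (a <= a * a)%N by rewrite leq_pmulr.
have cc : (c <= c * c)%N by rewrite leq_pmulr.
by split; lia.
Qed.

Lemma ell2_psi_reps N :
  (fps_coef (ell 2 * psi (q ^+ 3)) N)%:~R = (reps 2 1 (24 * N + 11))%:R :> 'F_2.
Proof.
pose P := 1 + \sum_(k < N)
  ((Xq ^+ 2) ^+ (k.+1 * k.+1 + tri k) + (Xq ^+ 2) ^+ (k.+1 * k.+1 + tri k.+1)).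
have -> : (fps_coef (ell 2 * psi (q ^+ 3)) N)%:~R =
    fps_coef (P * \sum_(i < N.+1) Xq ^+ (3 * tri i)) N :> 'F_2.
  rewrite !fps_coefM rmorph_sum; apply: eq_bigr => i _; rewrite rmorphM.
  have iN := ltn_ord i; congr (_ * _).
    apply: (etrans (coef_ell2 (N := N) _)); first by lia.
    apply: (cong_pow_coef (erefl (Xq ^+ 2)) (pentagonal pchar_fps _ N)); last by lia.
    by move=> k; exact: unit_1subXd.
  by apply: coef_psi3; lia.
rewrite /P pentagonal_index big_distrl.
rewrite (eq_bigr _ (fun u _ => big_distrr _ _ _)).
pose e (w : 'I_N.+1 * bool * 'I_N.+1) :=
 (2 * (w.1.1 * w.1.1 + tri (if w.1.2 then w.1.1 : nat else w.1.1.-1)) + 3 * tri w.2)%N.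
have -> : \sum_(u : 'I_N.+1 * bool | u.2 || (0 < u.1)%N) \sum_(i < N.+1)
     Xq ^+ (2 * (u.1 * u.1 + tri (if u.2 then u.1 : nat else u.1.-1))) * Xq ^+ (3 * tri i)
  = \sum_(w : 'I_N.+1 * bool * 'I_N.+1 | w.1.2 || (0 < w.1.1)%N) Xq ^+ e w.
  rewrite pair_big_dep; apply: eq_big => [[[k b] i]|[[k b] i] _] /=; rewrite ?andbT //.
  by rewrite /e exprD.
rewrite coef_sumXn; congr (_%:R); apply: esym.
apply: (@card_bij _ _ _ _ (fun w : 'I_N.+1 * bool * 'I_N.+1 =>
  (inord (if w.1.2 then 6 * w.1.1 + 1 else 6 * w.1.1 - 1)%N, inord (3 * (2 * w.2 + 1))%N))).
- move=> [[[k kN] b] [i iN]] [[[k' kN'] b'] [i' iN']]; rewrite !inE /e /=.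
  move=> /andP[kb /eqP ne] /andP[kb' /eqP ne'] [].
  have [_ _ aM cM _] := pentagonal_change_of_variables kb ne.
  have [_ _ aM' cM' _] := pentagonal_change_of_variables kb' ne'.
  move=> /(congr1 val) /= ha /(congr1 val) /= hc.
  rewrite !inordK // in ha; rewrite !inordK // in hc.
  have ii : i = i' by lia.
  have bb : b = b' by case: (b) (b') ha kb kb' => -[]; lia.
  have kk : k = k' by move: ha kb kb'; rewrite bb; case: (b'); lia.
  by rewrite bb; congr (_, _, _); apply: val_inj.
- move=> [[[k kN] b] [i iN]]; rewrite !inE /e /= => /andP[kb /eqP ne].
  have [a0 c0 aM cM ac] := pentagonal_change_of_variables kb ne.
  by rewrite !inordK // a0 c0 ac eqxx.
move=> [[a aM] [c cM]]; rewrite inE /= => /and3P[a0 c0 /eqP ac].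
have mod6 m : exists k, m = (6 * k)%N \/ m = (6 * k + 1)%N \/ m = (6 * k + 2)%N \/
    m = (6 * k + 3)%N \/ m = (6 * k + 4)%N \/ m = (6 * k + 5)%N.
  by exists (m %/ 6)%N; lia.
have [k0 aE0] := mod6 a; have [i cE0] := mod6 c.
have cE : c = (3 * (2 * i + 1))%N.
  by case: aE0 => [h|[h|[h|[h|[h|h]]]]]; case: cE0 => [h'|[h'|[h'|[h'|[h'|h']]]]];
    move: ac; rewrite h h'; lia.
have [k [b [kb aE]]] : exists k b, b || (0 < k)%N /\ a = (if b then 6 * k + 1 else 6 * k - 1)%N.
  case: aE0 => [h|[h|[h|[h|[h|h]]]]]; try by move: ac; rewrite h cE; lia.
    by exists k0, true.
  by exists k0.+1, false; split=> //; lia.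
have ne : (2 * (k * k + tri (if b then k else k.-1)) + 3 * tri i)%N = N.
  have Ti := double_tri i; move: ac; rewrite aE cE; case: (b) kb => /= [_|].
    by have Tk := double_tri k; lia.
  by case: (k) => // m _ /=; have Tm := double_tri m; lia.
have kN : (k < N.+1)%N.
  by have : (k <= k * k)%N; [case: (k) => // m; rewrite leq_pmulr | lia].
have iN : (i < N.+1)%N by have := leq_tri i; lia.
exists (Ordinal kN, b, Ordinal iN); first by rewrite inE /e /= kb ne eqxx.
by congr (_, _); apply: val_inj => /=; rewrite inordK -?aE -?cE.
Qed.

Lemma natr_F2 n : n%:R = (odd n)%:R :> 'F_2.
Proof.
rewrite -[in LHS](odd_double_half n) natrD -mul2n natrM.
by rewrite (pcharf0 (pchar_Fp (isT : prime 2))) mul0r addr0.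
Qed.

Lemma P_sigma_reps N : (P_sigma (2 * N + 1) = (reps 2 1 (24 * N + 11))%:Z %[mod 2])%Z.
Proof.
have M24 : ((24 * N + 11) %% 24 = 11)%N by lia.
apply/eqP; rewrite -intr_F2_eq P_sigma_cone_reps; last by lia.
have -> : (12 * (2 * N + 1) - 1 = 24 * N + 11)%N by lia.
by rewrite -pmulrn natr_F2 cone_reps_parity // repsC -reps_parity // -natr_F2.
Qed.

(** * The congruences *)

(* The divisions by 12 are exact, as p ^ 2 = 1 modulo 12. *)
Theorem theorem4p3 (p : nat) (p_prime : prime p) (p_ge5 : (5 <= p)%N)
    (p_leg : legendre (- 2) p = - 1) (alpha : nat) :
  fps_eqmod 2
    (Fps (fun n : nat =>
       P_sigma (2 * p ^ (2 * alpha) * n + (11 * p ^ (2 * alpha) + 1) %/ 12)%N))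
    (ell 2 * psi (q ^+ 3))
  /\
  (forall n j : nat, (1 <= j <= p - 1)%N ->
     (P_sigma (2 * p ^ (2 * alpha + 2) * n + 2 * p ^ (2 * alpha + 1) * j
               + (11 * p ^ (2 * alpha + 2) + 1) %/ 12)%N = 0 %[mod 2])%Z).
Proof.
have nz := legendreN2_ndvd p_prime p_leg; split=> [n|n j jp].
  rewrite [fps_coef (Fps _) n]/=.
  have P1 := prime_exp_mod24 alpha p_prime p_ge5.
  set P := (p ^ (2 * alpha))%N in P1 *.
  have [w wE] : exists w, P = (24 * w + 1)%N by exists (P %/ 24)%N; lia.
  have -> : (2 * P * n + (11 * P + 1) %/ 12 = 2 * (P * n + 11 * w) + 1)%N by lia.
  rewrite P_sigma_reps.
  have -> : (24 * (P * n + 11 * w) + 11 = P * (24 * n + 11))%N by lia.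
  rewrite reps_exp //; apply/eqP; rewrite -intr_F2_eq ell2_psi_reps.
  by rewrite -pmulrn.
have P1 := prime_exp_mod24 alpha.+1 p_prime p_ge5.
have e2 : (2 * alpha + 2 = 2 * alpha.+1)%N by lia.
have e1 : (p ^ (2 * alpha.+1) = p ^ (2 * alpha) * p * p)%N.
  by rewrite mulnS addnC expnD mulnA.
rewrite e2; set P := (p ^ (2 * alpha.+1))%N in P1 e1 *.
have [w wE] : exists w, P = (24 * w + 1)%N by exists (P %/ 24)%N; lia.
have -> : (p ^ (2 * alpha + 1) = p ^ (2 * alpha) * p)%N by rewrite expnD.
set R := (p ^ (2 * alpha))%N in e1 *.
have -> : (2 * P * n + 2 * (R * p) * j + (11 * P + 1) %/ 12 =
   2 * (P * n + R * p * j + 11 * w) + 1)%N by lia.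
rewrite P_sigma_reps.
have -> : (24 * (P * n + R * p * j + 11 * w) + 11 =
    R * (p * (24 * j + p * (24 * n + 11))))%N by lia.
rewrite reps_exp // reps_prime_mul //.
rewrite (dvdn_addl _ (dvdn_mulr _ (dvdnn p))) Euclid_dvdM // negb_or andbC gtnNdvd; [|lia|lia].
rewrite -[24%N]/(2 ^ 3 * 3)%N Euclid_dvdM // Euclid_dvdX // !dvdn_prime2 //= andbT.
by apply/norP; split; apply/eqP => p_eq; rewrite p_eq in p_ge5.
Qed.
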